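(* Let $\alpha_{1},\alpha_{2},\ldots$ be independent uniform random variables on $[0,1)$, $A_{j}(z)=\int_{0}^{z}2\sin^{2}(\pi(s+\alpha_{j}))\,ds$, $S_{n}=A_{n}\circ\cdots\circ A_{1}$, and for $f\in\mathcal{D}_{+}$ with distribution function $F$ let $f_{n}=S_{n}'(F)\,f$. Then for every $f\in\mathcal{D}_{+}$ and every $n$, $$\mathbb{E}\,D\big(f\,\|\,f_{n}\big)=n\log2,\qquad\mathbb{E}\,D\big(f_{n}\,\|\,f\big)=n\,(1-\log2),$$ with no lower-order correction, and $\tfrac1nD(f\|f_{n})\to\log2$ almost surely.
   Context: $\mathcal{D}_{+}$ is the set of probability densities on $\mathbb{R}$ that are continuous and strictly positive on an open interval and vanish outside it. $D(g\|h)=\int g\log(g/h)$ is relative entropy (natural logarithm). The density $f_{n}$ is the result of successively applying the operators $\rho_{w_{\alpha_{j}}}[g]=w_{\alpha_{j}}(G)\,g$ ($G$ the distribution function of $g$), $j=1,\ldots,n$, to $f$, where $w_{\alpha}(z)=2\sin^{2}(\pi(z+\alpha))$; expectations are over the phases $\alpha_{j}$. *)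

(* Defs.v *)
(* MathComp-Analysis *)
From HB Require Import structures.
From mathcomp Require Import all_boot all_order all_algebra.
From mathcomp Require Import all_classical all_reals all_analysis.

Set Implicit Arguments.
Unset Strict Implicit.
Unset Printing Implicit Defensive.

Import Order.TTheory GRing.Theory Num.Theory.
Import numFieldNormedType.Exports.

Local Open Scope classical_set_scope.
Local Open Scope ring_scope.

(* Nonnegativity and measurability of [f] follow from the last three clauses;
   [I] may be unbounded and is nonempty because the integral is 1. *)
Definition Dplus (R : realType) (f : R -> R) : Prop :=
  (\int[lebesgue_measure]_x (f x)%:E = 1)%E /\
  exists I : set R,
    [/\ open I, is_interval I, {within I, continuous f},
        (forall x, I x -> 0 < f x) & (forall x, ~ I x -> f x = 0)].

Definition distr_fun (R : realType) (f : R -> R) (x : R) : R :=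
  Rintegral lebesgue_measure `]-oo, x] f.

Definition weight (R : realType) (a z : R) : R :=
  2 * sin (pi * (z + a)) ^+ 2.

(* Meant for z in [0, 1], which it maps onto [0, 1]; the value is 0 for z < 0. *)
Definition wcum (R : realType) (a z : R) : R :=
  Rintegral lebesgue_measure `[0, z] (weight a).

(* The phases are numbered from 0: [a j] stands for the (j+1)-st phase. *)
Fixpoint wcomp (R : realType) (a : nat -> R) (n : nat) : R -> R :=
  if n is m.+1 then wcum (a m) \o wcomp a m else id.

(* The distribution function takes values in the open interval (0, 1) wherever
   [f] is nonzero, so [wcomp a n] is only differentiated at interior points. *)
Definition iter_density (R : realType) (f : R -> R) (a : nat -> R) (n : nat)
    (x : R) : R :=
  derive1 (wcomp a n) (distr_fun f x) * f x.

(* Conventions 0 log (0 / q) = 0 and p log (p / 0) = +oo for p <> 0. *)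
Definition kl_integrand (R : realType) (p q : R) : \bar R :=
  if p == 0 then 0%E else if q == 0 then +oo%E else (p * ln (p / q))%:E.

(* For densities the negative part of the integrand is integrable, so that the
   integral is well defined in \bar R. *)
Definition rel_entropy (R : realType) (g h : R -> R) : \bar R :=
  (\int[lebesgue_measure]_x kl_integrand (g x) (h x))%E.

Definition mutually_independent (R : realType) (d : measure_display)
    (T : measurableType d) (P : probability T R)
    (X : nat -> {RV P >-> R}) : Prop :=
  forall (J : seq nat) (B : nat -> set R), uniq J ->
    (forall j, measurable (B j)) ->
    P (\bigcap_(j in [set` J]) (X j @^-1` B j)) =
    (\prod_(j <- J) P (X j @^-1` B j))%E.

(* [uniform_prob] is the uniform law on the closed interval [0, 1], which as a
   measure is the uniform law on [0, 1). *)
Definition uniform01 (R : realType) (d : measure_display)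
    (T : measurableType d) (P : probability T R) (X : {RV P >-> R}) : Prop :=
  forall B : set R, measurable B ->
    distribution P X B = uniform_prob (@ltr01 R) B.

(* ['E_P[X]] only accepts real-valued X, while relative entropies live in
   \bar R. The integrability clause makes the expectation meaningful, since
   the library integral is total. *)
Definition has_expectation (R : realType) (d : measure_display)
    (T : measurableType d) (P : probability T R) (X : T -> \bar R) (c : R)
    : Prop :=
  P.-integrable setT X /\ (\int[P]_w X w = c%:E)%E.

(* Main.v *)
From HB Require Import structures.
Require Import Defs.
From mathcomp Require Import all_boot all_order all_algebra.
From mathcomp Require Import all_classical all_reals all_analysis.
From mathcomp Require Import measurable_realfun ring lra.
Set Implicit Arguments.
Unset Strict Implicit.
Unset Printing Implicit Defensive.
Import Order.TTheory GRing.Theory Num.Theory.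
Import numFieldNormedType.Exports.
Local Open Scope classical_set_scope.
Local Open Scope ring_scope.

(** Write [w(u) = 2 sin^2(pi u)].  By the chain rule [S_n'(z)] is the product
    of the factors [w(z_j + alpha_j)] along the orbit [z_j = S_j(z)], and
    [F(X)] is uniform on [[0, 1]] when [X] has density [f] ([distr_fun_law]).
    Hence, with [U] the uniform law,

      [D(f || f_n) = - int log S_n'(z) U(dz)],
      [D(f_n || f) = int S_n'(z) log S_n'(z) U(dz)],

    and nothing depends on [f] any more ([rel_entropy_iter_density],
    [rel_entropy_iter_density_rev]).  To work with nonnegative functions only,
    [- log w] is replaced by [psi = log 2 - log w >= 0], with value [+oo] at
    the zeros of [w], and [- log S_n'] by the sum [surp] of the [psi]-values
    along the orbit; Tonelli's theorem then needs no integrability.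

    Expectations are computed at a fixed starting point [z].  A sequence of
    independent uniform phases keeps its law when an independent uniform phase
    is put in front of it ([ge0_integral_scons]), which allows an induction on
    [n] that peels off the first map: it contributes [psi(z + alpha)] and moves
    the starting point.  Since [w] and [psi] have period 1, averages over
    [alpha] do not depend on [z], so all expectations are the same for every
    starting point and the induction closes.  The constants are

      [int psi = 2 log 2], [int w = 1], [int w psi = 2 log 2 - 1]

    over one period.  The first one follows from the duplication formula of the
    sine ([integral_psi]), the last one from an explicit primitive
    ([integral_sin2_psi]).  They give [n log 2] for the first expectation and
    [n log 2 - n (2 log 2 - 1) = n (1 - log 2)] for the second.

    For the almost sure statement, the conditional mean of each increment given
    the past is the constant [2 log 2]: the centred increments are orthogonal,
    and since [psi] is square integrable, the second moment of the centred sum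
    is a multiple of [n] ([expect_sqdev]).  Divided by [n^2] this is summable
    along the squares [n = k^2], which yields almost sure convergence there
    ([ae_squares]); as [D(f || f_n) + n log 2] is nondecreasing in [n], the
    indices between two squares follow ([cvg_average_of_squares]). *)

(** * Calculus for integrals of nonnegative functions *)

Section improper.
Context {R : realType}.
Notation mu := (@lebesgue_measure R).

(** The integrand may blow up at both ends: it is integrated over a compact
    exhaustion of the interval, and monotone convergence replaces any
    integrability hypothesis. *)
Lemma ge0_integral_oo_FTC (g G : R -> R) (a b A B : R) : a < b ->
  (forall x, a < x < b -> 0 <= g x) ->
  (forall x, a < x < b -> {for x, continuous g}) ->
  (forall x, a < x < b -> is_derive x (1:R) G (g x)) ->
  G x @[x --> a^'+] --> A -> G x @[x --> b^'-] --> B ->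
  (\int[mu]_(x in `]a, b[) (g x)%:E = (B - A)%:E)%E.
Proof.
move=> ab g0 cg dG GA GB.
(* With the denominator at least 3, the trimmed interval is nonempty for
   every [n]. *)
pose h n : R := (b - a) / n.+3%:R.
have h0 n : 0 < h n by rewrite divr_gt0// subr_gt0.
have h2 n : h n *+ 2 < b - a.
  rewrite /h -mulrnAl ltr_pdivrMr// -mulr_natr ltr_pM2l ?subr_gt0//.
  by rewrite ltr_nat.
have hcvg : h n @[n --> \oo] --> (0 : R).
  rewrite /h; rewrite -[X in _ --> X](mulr0 (b - a)); apply: cvgMr.
  rewrite (_ : (fun x => _) = (fun n => harmonic (n + 2)%N)); last first.
    by apply/funext => n; rewrite /harmonic addn2.
  by rewrite cvg_shiftn; exact: cvg_harmonic.
have hle m n : (m <= n)%N -> h n <= h m.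
  move=> mn; rewrite ler_pM2l ?subr_gt0// lef_pV2 ?posrE//.
  by rewrite ler_nat !ltnS.
have mg : measurable_fun `]a, b[ g.
  apply: open_continuous_measurable_fun => //.
  by move=> x; rewrite inE/= in_itv/=; exact: cg.
pose I n := `[a + h n, b - h n]%classic.
have subI n : I n `<=` `]a, b[.
  move=> x; rewrite /I/= !in_itv/= => /andP[h1 h3].
  by rewrite (lt_le_trans _ h1) ?ltrDl//= (le_lt_trans h3)// ltrBlDr ltrDl.
have iI n : (\int[mu]_(x in I n) (g x)%:E = (G (b - h n) - G (a + h n))%:E)%E.
  have hh := h2 n; have hh0 := h0 n.
  have aa : a < a + h n by rewrite ltrDl.
  have bb : b - h n < b by rewrite ltrBlDr ltrDl.
  rewrite EFinB; apply: continuous_FTC2.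
  - by move: hh; rewrite mulr2n; lra.
  - apply: continuous_in_subspaceT => x; rewrite inE => /subI/=.
    by rewrite in_itv/=; exact: cg.
  - have cG x : a < x < b -> {for x, continuous G}.
      move=> xab; apply: differentiable_continuous.
      by apply/derivable1_diffP; have [] := dG x xab.
    split.
    + move=> x xi; have : `]a, b[%classic x.
        by apply: (subI n); exact: subset_itv_oo_cc.
      by rewrite /= in_itv/= => /dG[].
    + by apply/cvg_at_right_filter/cG; rewrite aa/=; move: hh; rewrite mulr2n; lra.
    + by apply/cvg_at_left_filter/cG; rewrite bb andbT; move: hh; rewrite mulr2n; lra.
  - move=> x xi; have : `]a, b[%classic x.
      by apply: (subI n); exact: subset_itv_oo_cc.
    by rewrite /= in_itv/= derive1E => /dG[_ ->].
pose gn n x : \bar R := ((EFin \o g) \_ (I n)) x.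
have c1 : (\int[mu]_(x in `]a, b[) gn n x)%E @[n --> \oo] -->
    (\int[mu]_(x in `]a, b[) (g x)%:E)%E.
  suff -> : (\int[mu]_(x in `]a, b[) (g x)%:E =
      \int[mu]_(x in `]a, b[) limn (gn ^~ x))%E.
    apply: cvg_monotone_convergence => //.
    - move=> n; apply: measurable_funTS.
      apply/(measurable_restrictT _ _).1; first exact: measurable_itv.
      apply: (@measurable_funS _ _ _ _ `]a, b[%classic) => //.
      exact/measurable_EFinP.
    - move=> n x abx; apply: erestrict_ge0 => y /subI/=.
      by rewrite in_itv/= lee_fin => /g0.
    - move=> x; rewrite /= in_itv/= => xab m n mn.
      rewrite /gn /patch; case: ifPn => [/[!inE]/= xm|_].
        rewrite ifT// inE /I/= in_itv/=.
        move: xm; rewrite /I/= in_itv/= => /andP[x1 x2].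
        have hmn := hle _ _ mn.
        by rewrite (le_trans _ x1) ?lerD2l//= (le_trans x2)// lerD2l lerN2.
      by case: ifPn => // _; rewrite lee_fin g0.
  apply: eq_integral => x; rewrite inE/= in_itv/= => /andP[ax xb].
  apply/esym/cvg_lim => //; apply: cvg_near_cst.
  have : \forall n \near \oo, h n < Num.min (x - a) (b - x).
    by apply: cvgr_lt hcvg _ _; rewrite lt_min !subr_gt0 ax xb.
  apply: filterS => n; rewrite lt_min => /andP[n1 n2].
  rewrite /gn patchE ifT// inE /I/= in_itv/=.
  by rewrite -lerBrDl (ltW n1)/= lerBrDr -lerBrDl (ltW n2).
have c2 : (\int[mu]_(x in `]a, b[) gn n x)%E @[n --> \oo] --> (B - A)%:E.
  rewrite (_ : (fun n => _) = EFin \o (fun n => G (b - h n) - G (a + h n))).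
    apply: cvg_EFin; first exact: nearW.
    apply: cvgB.
    - move/cvg_at_leftP : GB; apply; split.
        by move=> n; rewrite ltrBlDr ltrDl.
      by rewrite -[X in _ --> X]subr0; apply: cvgB => //; exact: cvg_cst.
    - move/cvg_at_rightP : GA; apply; split.
        by move=> n; rewrite ltrDl.
      by rewrite -[X in _ --> X]addr0; apply: cvgD => //; exact: cvg_cst.
  apply/funext => n /=; rewrite -iI /gn.
  by rewrite -integral_mkcondr setIidr.
exact: (cvg_unique _ c1 c2).
Qed.

End improper.

Section affine.
Context {R : realType}.
Notation mu := (@lebesgue_measure R).

(** Lebesgue measure is characterized by its values on half-open intervals,
    and on these it agrees with [c] times its image under an affine map. *)
Lemma ge0_integral_affine (c d : R) (g : R -> \bar R) : 0 < c ->
  measurable_fun setT g -> (forall x, (0 <= g x)%E) ->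
  (\int[mu]_x g x = c%:E * \int[mu]_x g (c * x + d)%R)%E.
Proof.
move=> c0 mg g0.
pose phi (x : measurableTypeR R) : measurableTypeR R := c * x + d.
have mphi : measurable_fun setT phi.
  by apply: measurable_funD => //; exact: measurable_funM.
have cnn : 0 <= c by exact: ltW.
pose m := mscale (NngNum cnn)
  (measure_function_pushforward__canonical__measure_function_Measure mu mphi).
transitivity (\int[m]_x g x)%E.
  apply: eq_measure_integral => A mA _.
  apply: (@lebesgue_measure_unique R m) => // X [[a b]/= _ <-].
  pose J := `](a - d) / c, (b - d) / c]%classic.
  apply: (@etrans _ _ (c%:E * mu J)%E); last first.
    rewrite /mscale /= /pushforward; congr (_ * lebesgue_measure _)%E.
    apply/seteqP; split => x /=;
      rewrite /J /phi /= !in_itv/= ltr_pdivrMr// ler_pdivlMr//;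
      by rewrite (mulrC x) ltrBlDr lerBrDr.
  rewrite /J !lebesgue_measure_itv/= !lte_fin ltr_pM2r ?invr_gt0// ltrD2r.
  case: ifPn => _; last by rewrite mule0.
  by rewrite -EFinD -EFinM; congr EFin; field; rewrite gt_eqF.
rewrite ge0_integral_mscale//; congr (_ * _)%E => /=.
by rewrite ge0_integral_pushforward// => x _; exact: g0.
Qed.

Lemma ge0_integral_shift (d a b : R) (g : R -> \bar R) :
  measurable_fun setT g -> (forall x, (0 <= g x)%E) ->
  (\int[mu]_(x in `[a, b[) g (x + d)%R =
   \int[mu]_(x in `[(a + d)%R, (b + d)%R[) g x)%E.
Proof.
move=> mg g0; rewrite integral_mkcond [RHS]integral_mkcond.
rewrite [RHS](@ge0_integral_affine 1 d)//; last first.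
- by move=> x; exact: erestrict_ge0.
- by apply/(measurable_restrictT _ _).1 => //; exact: measurable_funTS.
rewrite mul1e; apply: eq_integral => x _; rewrite mul1r !patchE.
congr (if _ then _ else _); apply/idP/idP; rewrite !inE/= !in_itv/= lerD2r ltrD2r//.
Qed.

Lemma ge0_integral_itvD (a b c : R) (g : R -> \bar R) : a <= b -> b <= c ->
  measurable_fun setT g -> (forall x, (0 <= g x)%E) ->
  (\int[mu]_(x in `[a, c[) g x =
   \int[mu]_(x in `[a, b[) g x + \int[mu]_(x in `[b, c[) g x)%E.
Proof.
move=> ab bc mg g0.
have -> : `[a, c[%classic = `[a, b[ `|` `[b, c[ :> set R.
  apply/seteqP; split=> x /=; rewrite !in_itv/=.
    by move=> /andP[ax xc]; case: (ltP x b) => xb; [left|right]; rewrite ?ax ?xc.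
  move=> [|] /andP[ax xc]; rewrite ?ax ?xc ?andbT/=.
    exact: lt_le_trans bc.
  exact: le_trans ax.
rewrite ge0_integral_setU//; first exact: measurable_funTS.
apply/disj_setPS => x [] /=; rewrite !in_itv/= => /andP[_ xb] /andP[bx _].
by move: xb; rewrite ltNge bx.
Qed.

(** Only the fractional part [r] of the translation matters, and translating the
    unit interval by [r] trades its part [[0, r[] for [[1, 1 + r[], over which a
    periodic function has the same integral. *)
Lemma ge0_integral_periodic (d : R) (g : R -> \bar R) : 0 <= d ->
  measurable_fun setT g -> (forall x, (0 <= g x)%E) ->
  (forall x, g (x + 1)%R = g x) ->
  (\int[mu]_(x in `[0%R, 1%R[) g (x + d)%R = \int[mu]_(x in `[0%R, 1%R[) g x)%E.
Proof.
move=> d0 mg g0 g1.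
have gn n x : g (x + n%:R) = g x.
  elim: n => [|n ih]; first by rewrite addr0.
  by rewrite -natr1 addrA g1.
have [n [r [dE r0 r1]]] : exists n r, [/\ d = r + n%:R, 0 <= r & r < 1].
  exists (Num.trunc d), (d - (Num.trunc d)%:R).
  have /andP[h1 h2] := truncn_itv d0.
  by split; [rewrite subrK|rewrite subr_ge0|rewrite ltrBlDr addrC -natr1 // in h2 *].
transitivity (\int[mu]_(x in `[0%R, 1%R[) g (x + r)%R)%E.
  by apply: eq_integral => x _; rewrite dE addrA gn.
rewrite ge0_integral_shift// add0r (@ge0_integral_itvD r 1)//; last 2 first.
- exact: ltW.
- by rewrite lerDl.
rewrite [RHS](@ge0_integral_itvD 0 r)//; last exact: ltW.
rewrite addeC; congr (_ + _)%E.
have := @ge0_integral_shift 1 0 r g mg g0; rewrite add0r (addrC r) => <-.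
by apply: eq_integral => x _; rewrite g1.
Qed.

End affine.

(** * The logarithm of the sine *)

Section neglog.
Context {R : realType}.
Implicit Types x y : R.

(** Minus the logarithm on nonnegative reals, with value [+oo] at [0]: products
    become sums without exceptional points. *)
Definition nlog x : \bar R := (- lne x%:E)%E.

Lemma nlog_le0 x : x <= 0 -> nlog x = +oo%E.
Proof. by move=> x0; rewrite /nlog le0_lneNy. Qed.

Lemma nlog_gt0 x : 0 < x -> nlog x = (- ln x)%:E.
Proof. by move=> x0; rewrite /nlog lne_EFin. Qed.

Lemma nlogM x y : 0 <= x -> 0 <= y -> nlog (x * y) = (nlog x + nlog y)%E.
Proof.
rewrite le_eqVlt => /predU1P[<- _|x0].
  rewrite mul0r nlog_le0// addye// /nlog /=.
  by case: ifPn => // _; rewrite eqNyBy.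
rewrite le_eqVlt => /predU1P[<-|y0].
  by rewrite mulr0 (@nlog_le0 0)// (nlog_gt0 x0).
by rewrite !nlog_gt0 ?mulr_gt0// lnM ?posrE// opprD EFinD.
Qed.

Lemma nlog_ge0 x : x <= 1 -> (0 <= nlog x)%E.
Proof.
by move=> x1; rewrite /nlog oppe_ge0 lne_le0 lee_fin.
Qed.

Lemma measurable_nlog : measurable_fun setT nlog.
Proof.
rewrite (_ : nlog = fun x : R => if x <= 0 then +oo%E else (- ln x)%:E).
  apply: measurable_fun_ifT => //; first exact: measurable_fun_ler.
  by apply/measurable_EFinP; apply: measurableT_comp => //; exact: measurable_ln.
by apply/funext => x; case: leP => [/nlog_le0//|/nlog_gt0].
Qed.

(** This is [log 2 - log w] for the weight [w = 2 sin^2(pi x)]; the shift by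
    [log 2] makes it nonnegative. *)
Definition psi x : \bar R := nlog (sin (pi * x) ^+ 2).

Lemma psi_ge0 x : (0 <= psi x)%E.
Proof.
by apply: nlog_ge0; rewrite -real_normK ?num_real// expr_le1// sin_max.
Qed.

Lemma sin_pi_addr1 x : sin (pi * (x + 1)) ^+ 2 = sin (pi * x) ^+ 2 :> R.
Proof. by rewrite mulrDr mulr1 sinDpi sqrrN. Qed.

Lemma psi_addr1 x : psi (x + 1) = psi x.
Proof. by rewrite /psi sin_pi_addr1. Qed.

Lemma measurable_psi : measurable_fun setT psi.
Proof.
apply: measurableT_comp; first exact: measurable_nlog.
apply: measurable_funX; apply: measurableT_comp.
  by apply: continuous_measurable_fun; exact: continuous_sin.
exact: measurable_funM.
Qed.

(** The duplication formula [sin(2t) = 2 sin(t) cos(t)], with the cosine written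
    as a shifted sine. *)
Lemma psi_double x : (psi (2 * x) + (2 * ln 2)%:E = psi x + psi (x + 2^-1))%E.
Proof.
rewrite /psi -nlogM ?sqr_ge0//.
have -> : sin (pi * (x + 2^-1)) = cos (pi * x).
  by rewrite mulrDr sinDpihalf.
have -> : sin (pi * (2 * x)) ^+ 2 = 4 * (sin (pi * x) ^+ 2 * cos (pi * x) ^+ 2) :> R.
  by rewrite (_ : pi * (2 * x) = (pi * x) *+ 2) ?sin_mulr2n; ring.
rewrite (@nlogM 4)//; last by apply: mulr_ge0; exact: sqr_ge0.
rewrite addeAC (@nlog_gt0 4)// -EFinD.
have -> : - ln 4 + 2 * ln 2 = 0 :> R.
  by rewrite (_ : 4 = 2 ^+ 2 :> R) ?lnXn//; [rewrite mulr_natl addNr|ring].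
by rewrite add0e.
Qed.

(** Where [cos(pi x) >= 1/2], the mean value theorem bounds [sin(pi x)] from
    below by [pi x / 2 >= x]; elsewhere [sin(pi x) >= 1/2 >= x]. *)
Lemma sin_ge_id x : 0 <= x <= 2^-1 -> x <= sin (pi * x).
Proof.
move=> /andP[x0 x1].
have p2 := @pi_ge2 R.
have px0 : 0 <= pi * x by rewrite mulr_ge0 ?pi_ge0.
have pxh : pi * x <= pi / 2 by rewrite ler_pM2l ?pi_gt0.
have pxpi : pi * x <= pi by lra.
have s0 : 0 <= sin (pi * x).
  by rewrite sin_ge0_pi// px0.
have c0 : 0 <= cos (pi * x).
  by rewrite cos_ge0_pihalf// pxh andbT (le_trans _ px0)// oppr_le0 divr_ge0 ?pi_ge0.
have [c1|c1] := leP 2^-1 (cos (pi * x)); last first.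
  (* Here the squared sine exceeds 3/4. *)
  have := cos2Dsin2 (pi * x).
  nra.
have [c cI ->] : exists2 c, c \in `[0, pi * x]%R & sin (pi * x) = cos c * (pi * x).
  have dsin y : y \in `]0, (pi * x)[%R -> is_derive y (1 : R) sin (cos y).
    by move=> _; exact: is_derive_sin.
  have csin : {within `[0, pi * x], continuous (@sin R)}.
    by apply: continuous_subspaceT; exact: continuous_sin.
  have [c cI] := MVT_segment px0 dsin csin.
  by rewrite sin0 !subr0 => ->; exists c.
have cc : cos (pi * x) <= cos c.
  move: cI; rewrite in_itv/= => /andP[c0' c2].
  have [->//|ne] := eqVneq c (pi * x).
  rewrite ltW// ltr_cos ?in_itv/= ?c0' ?px0 ?(le_trans c2)//.
  by rewrite lt_neqAle ne.
have : 2^-1 * (pi * x) <= cos c * (pi * x).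
  by rewrite ler_wpM2r// (le_trans c1).
nra.
Qed.

(** The estimate [ln y < y] at [y = x^(-1/4)]: the exponent is small enough for
    the square of the bound to be integrable at [0]. *)
Lemma nln_le x : 0 < x -> - ln x <= 4 / Num.sqrt (Num.sqrt x).
Proof.
move=> x0.
have y0 : 0 < Num.sqrt (Num.sqrt x) by rewrite !sqrtr_gt0.
have -> : - ln x = 4 * ln (Num.sqrt (Num.sqrt x))^-1.
  rewrite lnV ?posrE// mulrN; congr (- _).
  rewrite mulr_natl -lnXn// (exprM _ 2 2) !sqr_sqrtr// ?sqrtr_ge0//.
  exact: ltW.
by rewrite ler_pM2l// ltW// ln_sublinear// invr_gt0.
Qed.

Lemma sqr_ln_le x : 0 < x <= 1 -> (- ln (x ^+ 2)) ^+ 2 <= 64 / Num.sqrt x.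
Proof.
move=> /andP[x0 x1].
have := nln_le x0; set y := Num.sqrt (Num.sqrt x) => h.
have y0 : 0 < y by rewrite !sqrtr_gt0.
have -> : Num.sqrt x = y ^+ 2 by rewrite sqr_sqrtr// sqrtr_ge0.
have l0 : 0 <= - ln x by rewrite oppr_ge0 ln_le0.
rewrite lnXn// (_ : - (ln x *+ 2) = 2 * (- ln x)); last by rewrite mulrN mulr_natl.
rewrite exprMn.
have : (- ln x) ^+ 2 <= (4 / y) ^+ 2 by rewrite ler_sqr// nnegrE divr_ge0// ltW.
rewrite expr_div_n -!(mulrC (y ^+ 2)^-1); lra.
Qed.

End neglog.

Section constants.
Context {R : realType}.
Notation mu := (@lebesgue_measure R).

Lemma sin_pi_gt0 (x : R) : 0 < x < 1 -> 0 < sin (pi * x).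
Proof.
move=> /andP[x0 x1]; apply: sin_gt0_pi.
by rewrite mulr_gt0 ?pi_gt0//= gtr_pMr ?pi_gt0.
Qed.

Lemma psi_oo (x : R) : 0 < x < 1 -> psi x = (- ln (sin (pi * x) ^+ 2))%:E.
Proof. by move=> /sin_pi_gt0 s0; rewrite /psi nlog_gt0// exprn_gt0. Qed.

(** The sine is compared with the distance to the nearer endpoint, each of
    which gets its own integrable term. *)
Lemma psi_sqr_le (x : R) : 0 < x < 1 ->
  (psi x * psi x <= (64 / Num.sqrt x + 64 / Num.sqrt (1 - x))%:E)%E.
Proof.
move=> x01; rewrite psi_oo// -EFinM lee_fin.
have s0 := sin_pi_gt0 x01.
have s1 : sin (pi * x) <= 1 by exact: sin_le1.
have [y [y0 y1 ys yle]] : exists y : R, [/\ 0 < y, y <= 1, y <= sin (pi * x) &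
    64 / Num.sqrt y <= 64 / Num.sqrt x + 64 / Num.sqrt (1 - x)].
  move: x01 => /andP[x0 x1].
  have q0 z : 0 <= 64 / Num.sqrt z :> R by rewrite divr_ge0// sqrtr_ge0.
  have [xh|xh] := leP x 2^-1.
    exists x; split => //; [exact: ltW|by apply: sin_ge_id; rewrite xh ltW|].
    by rewrite lerDl.
  exists (1 - x); split; [lra|lra| |by rewrite lerDr].
  have -> : sin (pi * x) = sin (pi * (1 - x)).
    by rewrite mulrBr mulr1 sinB sinpi cospi mul0r sub0r mulN1r opprK.
  by apply: sin_ge_id; lra.
apply: le_trans yle.
apply: le_trans (@sqr_ln_le R y _); last by rewrite y0.
have sq0 : 0 < sin (pi * x) ^+ 2 by rewrite exprn_gt0.
have h0 : 0 <= - ln (sin (pi * x) ^+ 2).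
  by rewrite oppr_ge0 ln_le0// expr_le1// ltW.
rewrite -expr2 ler_sqr ?nnegrE//.
  rewrite lerN2 ler_ln ?posrE ?exprn_gt0//.
  by rewrite lerXn2r// nnegrE ltW.
by rewrite oppr_ge0 ln_le0// expr_le1// ltW.
Qed.

Lemma integral_psi_sqr_fin :
  (\int[mu]_(x in `]0%R, 1%R[) (psi x * psi x) < +oo)%E.
Proof.
pose g (x : R) : R := 64 / Num.sqrt x + 64 / Num.sqrt (1 - x).
pose G (x : R) : R := 128 * Num.sqrt x - 128 * Num.sqrt (1 - x).
have cS (x : R) : {for x, continuous (fun y : R => Num.sqrt (1 - y))}.
  apply: continuous_comp; last exact: sqrt_continuous.
  by apply: continuousB; [exact: cst_continuous|exact: cvg_id].
have cG : continuous G.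
  by move=> x; apply: cvgB; apply: cvgMr; [exact: sqrt_continuous|exact: cS].
have gE : (\int[mu]_(x in `]0%R, 1%R[) (g x)%:E = (G 1 - G 0)%:E)%E.
  apply: (@ge0_integral_oo_FTC R g G 0 1 (G 0) (G 1) ltr01).
  - by move=> x _; rewrite addr_ge0// divr_ge0// sqrtr_ge0.
  - move=> x /andP[x0 x1]; apply: cvgD; apply: cvgMr; apply: cvgV.
    + by rewrite gt_eqF// sqrtr_gt0.
    + exact: sqrt_continuous.
    + by rewrite gt_eqF// sqrtr_gt0 subr_gt0.
    + exact: cS.
  - move=> x /andP[x0 x1].
    have d1 : is_derive x (1:R) (fun y : R => Num.sqrt (1 - y))
        (- (2 * Num.sqrt (1 - x))^-1).
      have dsq : is_derive (1 - x) (1:R) Num.sqrt (2 * Num.sqrt (1 - x))^-1.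
        by apply: is_derive1_sqrt; rewrite subr_gt0.
      have dl : is_derive x (1:R) (fun y : R => 1 - y) (-1).
        by apply: is_derive_eq; rewrite add0r mul1r.
      have := @is_derive1_comp R Num.sqrt (fun y => 1 - y) x _ _ dsq dl.
      by rewrite mulrN1.
    have d2 := is_derive1_sqrt x0.
    apply: is_derive_eq.
    have p1 : 0 < Num.sqrt x by rewrite sqrtr_gt0.
    have p2 : 0 < Num.sqrt (1 - x) by rewrite sqrtr_gt0 subr_gt0.
    rewrite /g /GRing.scale/=; field.
    by rewrite !gt_eqF.
  - exact/cvg_at_right_filter/cG.
  - exact/cvg_at_left_filter/cG.
apply: (@le_lt_trans _ _ (\int[mu]_(x in `]0%R, 1%R[) (g x)%:E)%E); last first.
  by rewrite gE ltry.
apply: ge0_le_integral => //=.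
- by move=> x _; rewrite mule_ge0// psi_ge0.
- apply: measurable_funTS; apply: emeasurable_funM; exact: measurable_psi.
- apply/measurable_EFinP; apply: open_continuous_measurable_fun => //.
  move=> x; rewrite inE/= in_itv/= => /andP[x0 x1].
  apply: cvgD; apply: cvgMr; apply: cvgV.
    + by rewrite gt_eqF// sqrtr_gt0.
    + exact: sqrt_continuous.
    + by rewrite gt_eqF// sqrtr_gt0 subr_gt0.
    + exact: cS.
- by move=> x; rewrite in_itv/= => x01; exact: psi_sqr_le.
Qed.

Lemma ge0_integral_bndo_oo (f : R -> \bar R) : measurable_fun setT f ->
  (\int[mu]_(x in `[0%R, 1%R[) f x = \int[mu]_(x in `]0%R, 1%R[) f x)%E.
Proof. by move=> mf; apply: integral_itv_bndoo; exact: measurable_funTS. Qed.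

(** Integrating the duplication formula over one period gives
    [I + 2 log 2 = I + I], because both the dilation by 2 and the translation by
    1/2 preserve the average of a periodic function.  Square integrability of
    [psi] makes [I] finite, so that it can be cancelled. *)
Lemma integral_psi : (\int[mu]_(x in `]0%R, 1%R[) psi x = (2 * ln 2)%:E)%E.
Proof.
rewrite -ge0_integral_bndo_oo; last exact: measurable_psi.
have mp := @measurable_psi R.
have p0 := @psi_ge0 R.
set I := (\int[mu]_(x in _) _)%E.
have I0 : (0 <= I)%E by apply: integral_ge0.
have Ifin : (I < +oo)%E.
  rewrite /I ge0_integral_bndo_oo//.
  apply: (@le_lt_trans _ _ (\int[mu]_(x in `]0%R, 1%R[) (psi x * psi x + 1))%E).
    apply: ge0_le_integral => //.
    - exact: measurable_funTS.
    - apply: measurable_funTS; apply: emeasurable_funD => //.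
      exact: emeasurable_funM.
    - move=> x; rewrite /= in_itv/= => x01; rewrite psi_oo// -EFinM -EFinD lee_fin.
      nra.
  rewrite ge0_integralD//=; last 2 first.
  - by move=> x _; rewrite mule_ge0.
  - by apply: measurable_funTS; exact: emeasurable_funM.
  rewrite integral_cst// mul1e /= lebesgue_measure_itv/= lte_fin ltr01.
  by rewrite lte_add_pinfty ?integral_psi_sqr_fin// -EFinB ltry.
(* Dilation by 2: the interval is covered twice at half the density. *)
have I2 : (I = \int[mu]_(x in `[0%R, 1%R[) psi (2 * x)%R)%E.
  have := @ge0_integral_affine R 2 0 (psi \_ `[0, 2[).
  rewrite -integral_mkcond.
  rewrite (@ge0_integral_itvD _ 0 1)// ?ler1n//.
  have := @ge0_integral_shift R 1 0 1 psi mp p0; rewrite add0r => <-.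
  under [X in (_ + X)%E]eq_integral do rewrite psi_addr1.
  rewrite -/I => h.
  set J := (\int[mu]_(x in _) _)%E in h *.
  transitivity J; last first.
    rewrite [RHS]integral_mkcond; apply: eq_integral => x _; rewrite addr0 !patchE.
    congr (if _ then _ else _); apply/idP/idP; rewrite !inE/= !in_itv/=; lra.
  have r0 (x : R) : (0 <= (@psi R \_ `[0%R, 2%R[) x)%E.
    by apply: erestrict_ge0 => y _; exact: p0.
  have J0 : (0 <= J)%E by apply: integral_ge0 => x _; exact: r0.
  have {h} : (I + I = 2%:E * J)%E.
    apply: h => //.
    by apply/(measurable_restrictT _ _).1 => //; exact: measurable_funTS.
  case: J J0 => [j||] J0 //; last first.
    rewrite gt0_muley// => h; have := lte_add_pinfty Ifin Ifin.
    by rewrite h.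
  rewrite -[I]fineK ?ge0_fin_numE// -EFinM -EFinD => -[h]; congr EFin; lra.
have : (I + (2 * ln 2)%:E = I + I)%E.
  rewrite [in LHS]I2.
  have -> : (2 * ln 2)%:E = (\int[mu]_(x in `[0%R, 1%R[) (cst (2 * ln 2)%:E x))%E.
    by rewrite integral_cst//= lebesgue_measure_itv/= lte_fin ltr01 -EFinB subr0 mule1.
  rewrite -ge0_integralD//; last 2 first.
  - by apply: measurable_funTS; apply: measurableT_comp => //; exact: measurable_funM.
  - by move=> x _; rewrite lee_fin mulr_ge0// ln_ge0// ler1n.
  transitivity (\int[mu]_(x in `[0%R, 1%R[) (psi x + psi (x + 2^-1)))%E.
    by apply: eq_integral => x _; exact: psi_double.
  rewrite ge0_integralD//; last 2 first.
  - exact: measurable_funTS.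
  - by apply: measurable_funTS; apply: measurableT_comp => //; exact: measurable_funD.
  congr (_ + _)%E; apply: ge0_integral_periodic => //; exact: psi_addr1.
rewrite -[I]fineK ?ge0_fin_numE// -!EFinD => -[/addrI h].
by rewrite h.
Qed.

End constants.

Section weighted.
Context {R : realType}.
Notation mu := (@lebesgue_measure R).

Let s (u : R) : R := sin (pi * u).
Let c (u : R) : R := cos (pi * u).
Let p (u : R) : R := - ln (s u ^+ 2).

Let ds (u : R) : is_derive u (1:R) s (pi * c u).
Proof.
have dl : is_derive u (1:R) (fun y : R => pi * y) pi.
  by apply: is_derive_eq; rewrite /GRing.scale/= mulr1.
have := @is_derive1_comp R sin (fun y => pi * y) u _ _ (is_derive_sin _) dl.
by rewrite mulrC.
Qed.

Let dc (u : R) : is_derive u (1:R) c (- (pi * s u)).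
Proof.
have dl : is_derive u (1:R) (fun y : R => pi * y) pi.
  by apply: is_derive_eq; rewrite /GRing.scale/= mulr1.
have := @is_derive1_comp R cos (fun y => pi * y) u _ _ (is_derive_cos _) dl.
by rewrite mulNr mulrC.
Qed.

Let dp (u : R) : 0 < u < 1 -> is_derive u (1:R) p (- (2 * pi * c u / s u)).
Proof.
move=> /sin_pi_gt0 s0.
have d2 : is_derive u (1:R) (fun y => s y ^+ 2) (2 * s u * (pi * c u)).
  by apply: is_derive_eq; rewrite /GRing.scale/= /c; ring.
have s20 : 0 < s u ^+ 2 by rewrite exprn_gt0.
have dl := @is_derive1_comp R (@ln R) (fun y => s y ^+ 2) u _ _
  (is_derive1_ln s20) d2.
apply: (@is_derive_eq _ _ _ _ _ _ _ _ (is_deriveN dl)).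
have : s u != 0 by rewrite gt_eqF.
by move=> s1; field.
Qed.

Let cs : continuous s.
Proof.
move=> u; apply: differentiable_continuous; apply/derivable1_diffP.
by have [] := ds u.
Qed.

Let cp (u : R) : 0 < u < 1 -> {for u, continuous p}.
Proof.
move=> u01; apply: differentiable_continuous; apply/derivable1_diffP.
by have [] := dp u01.
Qed.

Let p_ge0 (u : R) : 0 <= p u.
Proof.
by rewrite oppr_ge0 ln_le0// -real_normK ?num_real// expr_le1// sin_max.
Qed.

(** This makes the boundary terms of the integration vanish. *)
Let s_p_le (u : R) : 0 < u < 1 -> s u * p u <= 4 * Num.sqrt (s u).
Proof.
move=> /sin_pi_gt0; rewrite /p -/(s u); set x := s u => x0.
rewrite lnXn//.
have y0 : 0 < Num.sqrt x by rewrite sqrtr_gt0.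
have xy : x = Num.sqrt x ^+ 2 by rewrite sqr_sqrtr// ltW.
set y := Num.sqrt x in y0 xy *.
rewrite xy lnXn//.
have : ln y^-1 < y^-1 by apply: ln_sublinear; rewrite invr_gt0.
rewrite lnV ?posrE// => h.
have yy : y * y^-1 = 1 by rewrite mulfV// gt_eqF.
have : y ^+ 2 * - ln y <= y.
  rewrite -[leRHS]mulr1 -[X in _ <= _ * X]yy mulrA -expr2.
  by rewrite ler_wpM2l ?sqr_ge0// ltW.
rewrite -!(mulr_natl (ln y)) -!(mulr_natl (_ * _)); lra.
Qed.

(** The term [3 u] in the primitive [G] makes its derivative [g] nonnegative. *)
Let g (u : R) : R := (1 - 2 * s u ^+ 2) * p u + (2 * s u ^+ 2 + 1).
Let H (u : R) : R := s u * c u * p u / pi.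
Let G (u : R) : R := H u + 3 * u.

Let H_le (u : R) : 0 < u < 1 -> `|H u| <= 4 * Num.sqrt (s u).
Proof.
move=> u01; apply: le_trans (s_p_le u01).
have s0 := sin_pi_gt0 u01.
rewrite /H !normrM (ger0_norm (p_ge0 u)) (gtr0_norm s0) normfV (gtr0_norm (pi_gt0 R)).
have c1 : `|c u| <= 1 by exact: cos_max.
have p2 := @pi_ge2 R.
rewrite ler_pdivrMr ?pi_gt0//.
have := p_ge0 u.
have : 0 <= s u * p u by rewrite mulr_ge0// ltW.
have : s u * `|c u| * p u <= s u * p u.
  by rewrite ler_wpM2r// ler_piMr// ltW.
rewrite -/(s u); set a := s u * _ * _; set b := s u * p u => ab b0 _.
nra.
Qed.

Let cvgH0 (F : set_system R) (FF : Filter F) (z : R) : s z = 0 ->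
  (F --> z) -> (\forall u \near F, 0 < u < 1) -> H u @[u --> F] --> (0 : R).
Proof.
move=> sz Fz F01.
have k : (4 * Num.sqrt (s u)) @[u --> F] --> (0 : R).
  rewrite -[X in _ --> X](mulr0 4); apply: cvgMr.
  rewrite -(sqrtr0 R) -sz.
  apply: (@cvg_comp _ _ _ s Num.sqrt F (nbhs (s z))); last exact: sqrt_continuous.
  by apply: (@cvg_comp _ _ _ id s F (nbhs z)) => //; exact: cs.
apply/norm_cvg0P.
apply: (@squeeze_cvgr _ _ _ _ (cst 0) (fun u => 4 * Num.sqrt (s u))) k => //.
  by apply: filterS F01 => u u01; rewrite /= normr_ge0 H_le.
exact: cvg_cst.
Qed.

Let s0 : s 0 = 0. Proof. by rewrite /s mulr0 sin0. Qed.
Let s1 : s 1 = 0. Proof. by rewrite /s mulr1 sinpi. Qed.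

Let g_ge0 (u : R) : 0 < u < 1 -> 0 <= g u.
Proof.
move=> /sin_pi_gt0 su0; rewrite /g.
have p0 := p_ge0 u; have y0 : 0 < s u ^+ 2 by rewrite exprn_gt0.
have [y2|y2] := leP (s u ^+ 2) 2^-1; first nra.
have : p u < (s u ^+ 2)^-1.
  by rewrite /p -lnV ?posrE//; apply: ln_sublinear; rewrite invr_gt0.
have : (s u ^+ 2)^-1 < 2 by rewrite invf_plt ?posrE//.
have : s u ^+ 2 * (s u ^+ 2)^-1 = 1 by rewrite mulfV// gt_eqF.
nra.
Qed.

Let int_g : (\int[mu]_(u in `]0%R, 1%R[) (g u)%:E = 3%:E)%E.
Proof.
have -> : 3 = (0 + 3 * 1) - (0 + 3 * 0) :> R by ring.
apply: (@ge0_integral_oo_FTC R g G 0 1 _ _ ltr01).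
- exact: g_ge0.
- move=> u u01; apply: cvgD.
    apply: cvgM; last exact: cp.
    by apply: cvgB; [exact: cvg_cst|apply: cvgMr; apply: cvgM; exact: cs].
  by apply: cvgD; [apply: cvgMr; apply: cvgM; exact: cs|exact: cvg_cst].
- move=> u u01; have dpu := dp u01.
  have su0 : s u != 0 by rewrite gt_eqF// sin_pi_gt0.
  have pi0 : pi != 0 :> R by rewrite gt_eqF// pi_gt0.
  have cu : c u ^+ 2 = 1 - s u ^+ 2 by exact: cos2sin2.
  apply: is_derive_eq; rewrite /g /GRing.scale/=.
  have -> : 2 * s u ^+ 2 + 1 = 3 - 2 * c u ^+ 2 by rewrite cu; ring.
  have -> : 1 - 2 * s u ^+ 2 = c u ^+ 2 - s u ^+ 2 by rewrite cu; ring.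
  rewrite -/(s u) -/(c u) !mulr0 add0r.
  move: su0 pi0; move: (s u) (c u) (p u) (@pi R) => a b q k a0 k0.
  by field; apply/andP; split.
- apply: cvgD; last by apply: cvgMr; exact: cvg_at_right_filter.
  apply: (@cvgH0 _ _ 0) => //; first exact: cvg_at_right_filter.
  near=> u; apply/andP; split; near: u; first exact: nbhs_right_gt.
  exact: nbhs_right_lt.
- apply: cvgD; last by apply: cvgMr; exact: cvg_at_left_filter.
  apply: (@cvgH0 _ _ 1) => //; first exact: cvg_at_left_filter.
  near=> u; apply/andP; split; near: u; last exact: nbhs_left_lt.
  exact: nbhs_left_gt.
Unshelve. all: by end_near. Qed.

Let int_s : (\int[mu]_(u in `]0%R, 1%R[) (2 * s u ^+ 2 + 1)%:E = 2%:E)%E.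
Proof.
pose K (u : R) : R := 2 * u - s u * c u / pi.
have dK (u : R) : is_derive u (1:R) K (2 * s u ^+ 2 + 1).
  have pi0 : pi != 0 :> R by rewrite gt_eqF// pi_gt0.
  have cu : c u ^+ 2 = 1 - s u ^+ 2 by exact: cos2sin2.
  apply: is_derive_eq; rewrite /GRing.scale/=.
  have -> : 2 * s u ^+ 2 + 1 = 2 - (c u ^+ 2 - s u ^+ 2) by rewrite cu; ring.
  rewrite -/(s u) -/(c u) !mulr0 add0r.
  by move: pi0; move: (s u) (c u) (@pi R) => a b k k0; field.
have cK : continuous K.
  move=> u; apply: differentiable_continuous; apply/derivable1_diffP.
  by have [] := dK u.
transitivity (K 1 - K 0)%:E; last by congr EFin; rewrite /K s0 s1; ring.
apply: (@ge0_integral_oo_FTC R (fun u => 2 * s u ^+ 2 + 1) K 0 1 _ _ ltr01) => //.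
- by move=> u _; rewrite addr_ge0// mulr_ge0// sqr_ge0.
- by move=> u _; apply: cvgD; [apply: cvgMr; apply: cvgM; exact: cs|exact: cvg_cst].
- exact/cvg_at_right_filter/cK.
- exact/cvg_at_left_filter/cK.
Qed.

Lemma integral_sin2 : (\int[mu]_(u in `]0%R, 1%R[) (2 * sin (pi * u) ^+ 2)%:E = 1)%E.
Proof.
have ms : measurable_fun setT s by apply: continuous_measurable_fun; exact: cs.
have ms2 : measurable_fun setT (fun u => 2 * s u ^+ 2).
  by apply: measurable_funM => //; exact: measurable_funX.
set X := (\int[mu]_(u in _) _)%E.
have X0 : (0 <= X)%E.
  by apply: integral_ge0 => u _; rewrite lee_fin mulr_ge0// sqr_ge0.
have : (X + 1 = 2%:E)%E.
  have {1}-> : 1%E = (\int[mu]_(u in `]0%R, 1%R[) (cst 1%E u))%E :> \bar R.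
    by rewrite integral_cst//= lebesgue_measure_itv/= lte_fin ltr01 -EFinB subr0 mule1.
  rewrite -int_s /X -ge0_integralD//.
  - by move=> u _; rewrite lee_fin mulr_ge0// sqr_ge0.
  - by apply/measurable_EFinP; exact: measurable_funTS.
case: X X0 => [x||//] X0; last by [].
by rewrite -!EFinD => -[h]; congr EFin; lra.
Qed.

(** The function [s c p / pi] has derivative [(1 - 2 s^2) p - 2 c^2] and vanishes
    at both ends, so that [int 2 s^2 p = int p - 1].  In order to integrate
    nonnegative functions only, a constant 3 is added to this derivative. *)
Lemma integral_sin2_psi :
  (\int[mu]_(u in `]0%R, 1%R[) ((2 * sin (pi * u) ^+ 2)%:E * psi u) =
   (2 * ln 2 - 1)%:E)%E.
Proof.
have ms : measurable_fun setT s by apply: continuous_measurable_fun; exact: cs.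
have ms2 : measurable_fun setT (fun u => 2 * s u ^+ 2).
  by apply: measurable_funM => //; exact: measurable_funX.
have mp : measurable_fun (`]0, 1[%classic : set R) p.
  apply: open_continuous_measurable_fun => // u.
  by rewrite inE/= in_itv/=; exact: cp.
set X := (\int[mu]_(u in _) _)%E.
have X0 : (0 <= X)%E.
  apply: integral_ge0 => u _; rewrite mule_ge0 ?psi_ge0// lee_fin.
  by rewrite mulr_ge0// sqr_ge0.
have : (3%:E + X = (2 * ln 2)%:E + 2%:E)%E.
  rewrite -int_g -integral_psi -int_s /X -!ge0_integralD//; last first.
  - apply: measurable_funTS; apply: emeasurable_funM; last exact: measurable_psi.
    exact/measurable_EFinP.
  - move=> u _; rewrite mule_ge0 ?psi_ge0// lee_fin.
    by rewrite mulr_ge0// sqr_ge0.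
  - apply/measurable_EFinP; apply: measurable_funD.
      apply: measurable_funM => //; apply: measurable_funTS.
      exact: measurable_funB.
    by apply: measurable_funTS; exact: measurable_funD.
  - by apply/measurable_EFinP; apply: measurable_funTS; exact: measurable_funD.
  - by move=> u _; rewrite lee_fin addr_ge0// mulr_ge0// sqr_ge0.
  - by apply: measurable_funTS; exact: measurable_psi.
  - by move=> u _; exact: psi_ge0.
  apply: eq_integral => u; rewrite inE/= in_itv/= => u01.
  rewrite psi_oo// -EFinM -!EFinD; congr EFin.
  by rewrite /g -/(s u) -/(p u); ring.
case: X X0 => [x||//] X0; last by [].
by rewrite -!EFinD => -[h]; congr EFin; lra.
Qed.

End weighted.

(** * Averages over one uniform phase *)

Section uniform.
Context {R : realType}.
Notation mu := (@lebesgue_measure R).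
Notation U := (uniform_prob (@ltr01 R)).

Lemma integral_U01 (g : R -> \bar R) : measurable_fun setT g ->
  (forall x, (0 <= g x)%E) ->
  (\int[U]_x g x = \int[mu]_(x in `]0%R, 1%R[) g x)%E.
Proof.
move=> mg g0; rewrite integral_uniform// subr0 invr1 mul1e.
by apply: integral_itv_bndoo; exact: measurable_funTS.
Qed.

Lemma integral_U01_shift (z : R) (g : R -> \bar R) : 0 <= z ->
  measurable_fun setT g -> (forall x, (0 <= g x)%E) ->
  (forall x, g (x + 1)%R = g x) ->
  (\int[U]_u g (z + u)%R = \int[mu]_(x in `]0%R, 1%R[) g x)%E.
Proof.
move=> z0 mg g0 g1.
rewrite integral_U01//; last first.
  by apply: measurableT_comp => //; exact: measurable_funD.
rewrite -ge0_integral_bndo_oo; last first.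
  by apply: measurableT_comp => //; exact: measurable_funD.
rewrite -ge0_integral_bndo_oo// -[RHS](ge0_integral_periodic z0)//.
by apply: eq_integral => x _; rewrite addrC.
Qed.

Lemma U01_psi (z : R) : 0 <= z -> (\int[U]_u psi (z + u)%R = (2 * ln 2)%:E)%E.
Proof.
move=> z0; rewrite integral_U01_shift ?integral_psi//.
- exact: measurable_psi.
- exact: psi_ge0.
- exact: psi_addr1.
Qed.

Definition psi_moment2 : R := fine (\int[mu]_(x in `]0%R, 1%R[) (psi x * psi x))%E.

Lemma U01_psi_sqr (z : R) : 0 <= z ->
  (\int[U]_u (psi (z + u)%R * psi (z + u)%R) = psi_moment2%:E)%E.
Proof.
move=> z0; rewrite (@integral_U01_shift _ (fun x => psi x * psi x)%E)//.
- rewrite /psi_moment2 fineK// ge0_fin_numE ?integral_psi_sqr_fin//.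
  by apply: integral_ge0 => x _; rewrite mule_ge0 ?psi_ge0.
- by apply: emeasurable_funM; exact: measurable_psi.
- by move=> x; rewrite mule_ge0 ?psi_ge0.
- by move=> x; rewrite psi_addr1.
Qed.

Lemma measurable_sin_pi : measurable_fun setT (fun u : R => sin (pi * u)).
Proof.
apply: measurableT_comp; last exact: measurable_funM.
by apply: continuous_measurable_fun; exact: continuous_sin.
Qed.

Lemma measurable_sin2 : measurable_fun setT (fun u : R => 2 * sin (pi * u) ^+ 2).
Proof.
by apply: measurable_funM => //; apply: measurable_funX; exact: measurable_sin_pi.
Qed.

Lemma weight_ge0 (a z : R) : 0 <= weight a z.
Proof. by rewrite mulr_ge0// sqr_ge0. Qed.

Lemma U01_weight (z : R) : 0 <= z -> (\int[U]_u (weight u z)%:E = 1)%E.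
Proof.
move=> z0.
rewrite (@integral_U01_shift _ (fun x => (2 * sin (pi * x) ^+ 2)%:E)%E)//.
- exact: integral_sin2.
- by apply/measurable_EFinP; exact: measurable_sin2.
- by move=> x; rewrite lee_fin mulr_ge0// sqr_ge0.
- by move=> x; rewrite sin_pi_addr1.
Qed.

Lemma U01_weight_psi (z : R) : 0 <= z ->
  (\int[U]_u ((weight u z)%:E * psi (z + u)%R) = (2 * ln 2 - 1)%:E)%E.
Proof.
move=> z0.
rewrite (@integral_U01_shift _ (fun x => (2 * sin (pi * x) ^+ 2)%:E * psi x)%E)//.
- exact: integral_sin2_psi.
- apply: emeasurable_funM; last exact: measurable_psi.
  by apply/measurable_EFinP; exact: measurable_sin2.
- by move=> x; rewrite mule_ge0 ?psi_ge0// lee_fin mulr_ge0// sqr_ge0.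
- by move=> x; rewrite sin_pi_addr1 psi_addr1.
Qed.

End uniform.

(** * Sequences of independent uniform phases *)

Section seqspace.
Context {R : realType}.
Notation U := (uniform_prob (@ltr01 R)).

Definition box (n : nat) (B : nat -> set R) : set (nat -> R) :=
  [set a | forall j, (j < n)%N -> B j (a j)].

(** Product sets that restrict finitely many coordinates: a family closed under
    finite intersections, which therefore determines a probability. *)
Definition boxes : set (set (nat -> R)) :=
  [set A | exists n B, (forall j, measurable (B j)) /\ A = box n B].

(** Sequences of phases, with the sigma-algebra generated by the coordinates. *)
Definition phases := g_sigma_algebraType boxes.

Lemma boxes_setI : setI_closed boxes.
Proof.
move=> _ _ [n [B [mB ->]]] [m [C [mC ->]]].
pose D j := (if (j < n)%N then B j else setT) `&` (if (j < m)%N then C j else setT).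
exists (maxn n m), D; split.
  by move=> j; apply: measurableI; case: ifP.
apply/seteqP; split => a.
  move=> [Ba Ca] j jnm; split; case: ifP => // jn; [exact: Ba|exact: Ca].
move=> Da; split=> j jn.
  by have [] := Da j; rewrite ?leq_max jn.
by have [] := Da j; rewrite ?leq_max jn ?orbT.
Qed.

Lemma measurable_box n B : (forall j, measurable (B j)) ->
  measurable (box n B : set phases).
Proof. by move=> mB; apply: sub_sigma_algebra; exists n, B. Qed.

Lemma measurable_coord (j : nat) : measurable_fun setT (fun a : phases => a j).
Proof.
move=> _ B mB; rewrite setTI.
rewrite (_ : _ @^-1` _ = box j.+1 (fun i => if i == j then B else setT)).
  by apply: measurable_box => i; case: ifP.
apply/seteqP; split => a /=.
  by move=> Ba i _; case: eqVneq => [->|].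
by move=> /(_ j (ltnSn j)); rewrite eqxx.
Qed.

Lemma measurable_to_phases d (T : measurableType d) (h : T -> phases) :
  (forall j, measurable_fun setT (fun t => h t j)) -> measurable_fun setT h.
Proof.
move=> mh; apply: (@measurability _ _ T phases setT h boxes) => //.
move=> _ [_ [n [B [mB ->]]] <-]; rewrite setTI.
rewrite (_ : _ @^-1` _ = \bigcap_(j < n) ((fun t => h t j) @^-1` B j)).
  apply: bigcap_measurableType.
  by move=> j _; rewrite -[X in measurable X]setTI; exact: mh.
by apply/seteqP; split => t /= H j; exact: H.
Qed.

Definition scons (u : R) (a : nat -> R) : nat -> R :=
  fun j => if j is i.+1 then a i else u.

Definition sconsp (p : R * phases) : phases := scons p.1 p.2.

Lemma measurable_sconsp : measurable_fun setT sconsp.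
Proof.
apply: measurable_to_phases => -[|j]; first exact: measurable_fst.
exact: (measurableT_comp (measurable_coord j)).
Qed.

Variable Q : probability phases R.
Hypothesis QE : forall n B, (forall j, measurable (B j)) ->
  Q (box n B) = (\prod_(j < n) U (B j))%E.

(** Both sides integrate against probabilities, the right one being the image of
    [U \x Q] under prepending.  The factors of a box split into the first one and
    those of a box for the remaining coordinates, so the two probabilities agree
    on boxes, hence everywhere. *)
Lemma ge0_integral_scons (phi : phases -> \bar R) :
  measurable_fun setT phi -> (forall a, (0 <= phi a)%E) ->
  (\int[Q]_a phi a = \int[U]_u \int[Q]_a phi (scons u a))%E.
Proof.
move=> mphi phi0.
pose m := measure_function_pushforward__canonical__measure_function_Measure
  (U \x Q)%E measurable_sconsp.
transitivity (\int[m]_a phi a)%E.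
  apply: eq_measure_integral => A mA _.
  apply: (@measure_unique _ R phases boxes (fun=> setT)) => //.
  - exact: boxes_setI.
  - by move=> _; exists 0%N, (fun=> setT); split => //; apply/seteqP; split.
  - by apply/seteqP; split => // a _; exists 0%N.
  - move=> _ [n [B [mB ->]]].
    apply: (eq_trans (@QE n B mB)); rewrite /m /= /pushforward.
    case: n => [|n].
      rewrite big_ord0 [X in product_measure1 _ _ X](_ : _ = setT `*` setT).
        rewrite product_measure1E// -(@probability_setT _ _ _ Q).
        by rewrite [X in _ = (X * _)%E]probability_setT mul1e.
      by apply/seteqP; split.
    rewrite [X in product_measure1 _ _ X](_ : _ = B 0%N `*` box n (B \o S)).
      rewrite product_measure1E//; last by apply: measurable_box => j; exact: mB.
      rewrite big_ord_recl; congr (_ * _)%E.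
      by apply/esym/QE => j; exact: mB.
      exact: mB.
    apply/seteqP; split => -[u a] /=.
      by move=> H; split; [exact: (H 0%N)|move=> j jn; exact: (H j.+1)].
    by move=> [H1 H2] [|j] jn //=; exact: H2.
  - by move=> _; rewrite [X in (X < _)%E](@probability_setT _ _ _ Q) ltry.
rewrite ge0_integral_pushforward//=.
rewrite fubini_tonelli1//.
- by apply: measurableT_comp => //; exact: measurable_sconsp.
- exact: measurable_sconsp.
Qed.

End seqspace.

(** * The iterated map and its derivative *)

Section cumulative_weight.
Context {R : realType}.
Notation mu := (@lebesgue_measure R).
Implicit Types (a z : R).

(** The primitive of the weight [1 - cos(2 pi (z + a))] that vanishes at [0]. *)
Definition wcum_closed a z : R :=
  z - (sin (2 * pi * (z + a)) - sin (2 * pi * a)) / (2 * pi).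

Lemma is_derive_wcum_closed a z :
  is_derive z (1:R) (wcum_closed a) (weight a z).
Proof.
have pi0 : pi != 0 :> R by rewrite gt_eqF// pi_gt0.
have dl : is_derive z (1:R) (fun y : R => 2 * pi * (y + a)) (2 * pi).
  by apply: is_derive_eq; rewrite /GRing.scale/= addr0 mulr1.
have ds : is_derive z (1:R) (fun y : R => sin (2 * pi * (y + a)))
    (cos (2 * pi * (z + a)) * (2 * pi)).
  exact: (@is_derive1_comp R sin (fun y => 2 * pi * (y + a)) z _ _
    (is_derive_sin _) dl).
apply: is_derive_eq.
have -> : cos (2 * pi * (z + a)) = 1 - 2 * sin (pi * (z + a)) ^+ 2.
  rewrite (_ : 2 * pi * (z + a) = (pi * (z + a)) *+ 2); last by ring.
  by rewrite cos_mulr2n cos2sin2; ring.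
rewrite /weight /GRing.scale/=.
move: pi0; move: (@pi R) (sin _) (sin _) (sin _) => k p q s k0.
by field.
Qed.

Lemma continuous_weight a : continuous (weight a).
Proof.
move=> z; apply: cvgMr.
have cs : continuous (fun y : R => sin (pi * (y + a))).
  move=> y; apply: (@cvg_comp _ _ _ (fun y => pi * (y + a)) sin (nbhs y)
    (nbhs (pi * (y + a)))); last exact: continuous_sin.
  by apply: cvgMr; apply: cvgD; [exact: cvg_id|exact: cvg_cst].
by apply: cvgM; exact: cs.
Qed.

Lemma wcumE a z : 0 <= z -> wcum a z = wcum_closed a z.
Proof.
rewrite le_eqVlt => /predU1P[<-|z0].
  by rewrite /wcum set_itv1 Rintegral_set1 /wcum_closed (add0r a) subrr mul0r subrr.
have cW : continuous (wcum_closed a).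
  move=> x; apply: differentiable_continuous; apply/derivable1_diffP.
  by have [] := is_derive_wcum_closed a x.
rewrite /wcum /Rintegral (@continuous_FTC2 R (weight a) (wcum_closed a))//.
- by rewrite -EFinB /= /wcum_closed (add0r a) subrr mul0r subrr subr0.
- by apply: continuous_subspaceT; exact: continuous_weight.
- split.
  + by move=> x _; have [] := is_derive_wcum_closed a x.
  + exact/cvg_at_right_filter/cW.
  + exact/cvg_at_left_filter/cW.
- by move=> x _; rewrite derive1E; have [_ ->] := is_derive_wcum_closed a x.
Qed.

Lemma wcum_lt0 a z : z < 0 -> wcum a z = 0.
Proof.
by move=> z0; rewrite /wcum set_itv_ge ?Rintegral_set0// bnd_simp -ltNge.
Qed.

Lemma wcum_ge0 a z : 0 <= wcum a z.
Proof. by apply: Rintegral_ge0 => x _; exact: weight_ge0. Qed.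

Lemma normr_sin_lt (t : R) : 0 < t -> `|sin t| < t.
Proof.
move=> t0; have [t1|t1] := ltP 1 t; first exact: le_lt_trans (sin_max t) t1.
have tp : t < pi by rewrite (le_lt_trans t1)// (lt_le_trans _ (@pi_ge2 R))// ltr1n.
rewrite gtr0_norm; last by rewrite sin_gt0_pi// t0.
have dsin y : y \in `]0, t[%R -> is_derive y (1 : R) sin (cos y).
  by move=> _; exact: is_derive_sin.
have csin : {within `[0, t], continuous (@sin R)}.
  by apply: continuous_subspaceT; exact: continuous_sin.
have [c] := MVT t0 dsin csin.
rewrite in_itv/= sin0 !subr0 => /andP[c0 ct] ->.
rewrite gtr_pMl// -cos0 ltr_cos ?in_itv/= ?lexx ?pi_ge0 ?(ltW c0)//=.
by rewrite ltW// (lt_trans ct).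
Qed.

(** By the sum-to-product formula, [wcum a z] equals
    [z - sin(pi z) cos(pi (z + 2 a)) / pi] for [z >= 0].  Positivity keeps the
    orbit of a positive point away from [0], where [wcum a], being zero on the
    left, need not be differentiable. *)
Lemma wcum_gt0 a z : 0 < z -> 0 < wcum a z.
Proof.
move=> z0; rewrite wcumE ?ltW// /wcum_closed.
have p0 := pi_gt0 R.
rewrite subr_gt0 ltr_pdivrMr ?mulr_gt0//.
have pz : 0 < pi * z by rewrite mulr_gt0.
have := normr_sin_lt pz.
set y := pi * (z + a) + pi * a.
have -> : 2 * pi * (z + a) = y + pi * z by rewrite /y; ring.
have -> : 2 * pi * a = y - pi * z by rewrite /y; ring.
rewrite sinD sinB.
have -> : sin y * cos (pi * z) + cos y * sin (pi * z) -
  (sin y * cos (pi * z) - cos y * sin (pi * z)) = 2 * (cos y * sin (pi * z)).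
  by ring.
move=> h; have : cos y * sin (pi * z) < pi * z; last lra.
apply: le_lt_trans h; apply: le_trans (ler_norm _) _.
by rewrite normrM ler_piMl// cos_max.
Qed.

Lemma is_derive_wcum a z : 0 < z -> is_derive z (1:R) (wcum a) (weight a z).
Proof.
move=> z0; apply: near_eq_is_derive (is_derive_wcum_closed a z).
near=> y; rewrite wcumE// ltW//; near: y; exact: lt_nbhsr.
Unshelve. all: by end_near. Qed.

Lemma measurable_wcum : measurable_fun setT (fun p : R * R => wcum p.1 p.2).
Proof.
rewrite (_ : (fun p => _) = fun p : R * R =>
    if p.2 < 0 then 0 else wcum_closed p.1 p.2); last first.
  by apply/funext => -[a z] /=; case: ltP => [/wcum_lt0//|/wcumE].
have ms : measurable_fun setT (fun u : R => sin (2 * pi * u)).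
  apply: measurableT_comp; last exact: measurable_funM.
  by apply: continuous_measurable_fun; exact: continuous_sin.
apply: measurable_fun_ifT => //; first exact: measurable_fun_ltr.
apply: measurable_funB => //; apply: measurable_funM => //.
apply: measurable_funB; last exact: (measurableT_comp ms measurable_fst).
by apply: (measurableT_comp ms); exact: measurable_funD.
Qed.

End cumulative_weight.

Section iterated_map.
Context {R : realType}.
Implicit Types (a : nat -> R) (z u : R) (n : nat).

(** The maps are numbered in the order in which they act, so prepending a phase
    changes the starting point. *)
Lemma wcomp_scons n u a z :
  wcomp (scons u a) n.+1 z = wcomp a n (wcum u z).
Proof. by elim: n => [//|n ih] /=; rewrite -ih. Qed.

Lemma wcomp_gt0 a n z : 0 < z -> 0 < wcomp a n z.
Proof. by move=> z0; elim: n => [//|n ih]; exact: wcum_gt0. Qed.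

(** The derivative [S_n'(z)], by the chain rule a product of the weights seen
    along the orbit of [z]. *)
Definition jac n a z : R := \prod_(j < n) weight (a j) (wcomp a j z).

(** [n log 2 - log S_n'(z)], with value [+oo] where [S_n'(z) = 0]. *)
Definition surp n a z : \bar R := (\sum_(j < n) psi (wcomp a j z + a j)%R)%E.

Lemma is_derive_wcomp n a z : 0 < z -> is_derive z (1:R) (wcomp a n) (jac n a z).
Proof.
move=> z0; elim: n => [|n ih].
  by rewrite /jac big_ord0; exact: is_derive_id.
rewrite /jac big_ord_recr/= mulrC.
exact: (@is_derive1_comp R (wcum (a n)) (wcomp a n) z _ _
  (is_derive_wcum (a n) (wcomp_gt0 a n z0)) ih).
Qed.

Lemma jac_ge0 n a z : 0 <= jac n a z.
Proof. by apply: prodr_ge0 => j _; exact: weight_ge0. Qed.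

Lemma weight_le2 u z : weight u z <= 2.
Proof.
have : sin (pi * (z + u)) ^+ 2 <= 1.
  by rewrite -real_normK ?num_real// expr_le1// sin_max.
by rewrite /weight; lra.
Qed.

Lemma jac_le n a z : jac n a z <= 2 ^+ n.
Proof.
elim: n => [|n ih]; first by rewrite /jac big_ord0.
rewrite /jac big_ord_recr/= exprSr ler_pM ?jac_ge0//.
- exact: weight_ge0.
- exact: weight_le2.
Qed.

Lemma surp_ge0 n a z : (0 <= surp n a z)%E.
Proof. by apply: sume_ge0 => j _; exact: psi_ge0. Qed.

Lemma jac_scons n u a z : jac n.+1 (scons u a) z = weight u z * jac n a (wcum u z).
Proof.
rewrite /jac big_ord_recl; congr (_ * _).
by apply: eq_bigr => i _; rewrite wcomp_scons.
Qed.

Lemma surp_scons n u a z :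
  surp n.+1 (scons u a) z = (psi (z + u)%R + surp n a (wcum u z))%E.
Proof.
rewrite /surp big_ord_recl; congr (_ + _)%E.
by apply: eq_bigr => i _; rewrite wcomp_scons.
Qed.

(** Each factor of [S_n'] contributes [psi - log 2]. *)
Lemma nlog_jac n a z : nlog (jac n a z) = (surp n a z - (n%:R * ln 2)%:E)%E.
Proof.
elim: n => [|n ih].
  by rewrite /jac /surp !big_ord0 mul0r sube0 nlog_gt0// ln1 oppr0.
rewrite /jac /surp !big_ord_recr/= nlogM ?weight_ge0//; last exact: jac_ge0.
rewrite ih /weight nlogM ?sqr_ge0// (@nlog_gt0 _ 2)// -/(psi _).
rewrite -/(surp n a z) (addeC (- ln 2)%:E) addeACA -EFinN -EFinD.
by rewrite -[n.+1%:R]natr1 mulrDl mul1r opprD.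
Qed.

Lemma measurable_wcomp n :
  measurable_fun setT (fun p : @phases R * R => wcomp p.1 n p.2).
Proof.
elim: n => [|n ih] /=; first exact: measurable_snd.
have mp : measurable_fun setT (fun p : @phases R * R => (p.1 n, wcomp p.1 n p.2)).
  apply/measurable_fun_pairP; split => //.
  exact: (measurableT_comp (measurable_coord n)).
exact: (measurableT_comp measurable_wcum mp).
Qed.

Lemma measurable_orbit n : measurable_fun setT
  (fun p : @phases R * R => wcomp p.1 n p.2 + p.1 n).
Proof.
apply: measurable_funD; first exact: measurable_wcomp.
exact: (measurableT_comp (measurable_coord n)).
Qed.

Lemma measurable_jac n :
  measurable_fun setT (fun p : @phases R * R => jac n p.1 p.2).
Proof.
apply: measurable_prod => j _.
exact: (measurableT_comp measurable_sin2 (measurable_orbit j)).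
Qed.

Lemma measurable_surp n :
  measurable_fun setT (fun p : @phases R * R => surp n p.1 p.2).
Proof.
apply: emeasurable_sum => j.
exact: (measurableT_comp measurable_psi (measurable_orbit j)).
Qed.

End iterated_map.

(** * Moments of the logarithmic derivative at a fixed point *)

Section expectations.
Context {R : realType}.
Notation U := (uniform_prob (@ltr01 R)).
Variable Q : probability (@phases R) R.
Hypothesis QE : forall n B, (forall j, measurable (B j)) ->
  Q (box n B) = (\prod_(j < n) U (B j))%E.
Implicit Types (z : R) (n : nat).

Lemma integral_prob_cstD d (T : measurableType d) (P : probability T R)
    (c : \bar R) (g : T -> \bar R) : (0 <= c)%E ->
  measurable_fun setT g -> (forall t, (0 <= g t)%E) ->
  (\int[P]_t (c + g t) = c + \int[P]_t g t)%E.
Proof.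
move=> c0 mg g0; rewrite ge0_integralD//; congr (_ + _)%E.
by rewrite integral_cst//= probability_setT mule1.
Qed.

Lemma measurable_surp1 n z : measurable_fun setT (fun a : @phases R => surp n a z).
Proof. exact: (measurableT_comp (measurable_surp n) (measurable_pair2 z)). Qed.

Lemma measurable_jac1 n z : measurable_fun setT (fun a : @phases R => jac n a z).
Proof. exact: (measurableT_comp (measurable_jac n) (measurable_pair2 z)). Qed.

Lemma measurable_psiD z : measurable_fun setT (fun u : R => psi (z + u)%R).
Proof. by apply: (measurableT_comp measurable_psi); exact: measurable_funD. Qed.

Lemma measurable_weightl z : measurable_fun setT (fun u : R => weight u z).
Proof.
have mD : measurable_fun setT (fun u : R => z + u) by exact: measurable_funD.
exact: (measurableT_comp measurable_sin2 mD).
Qed.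

Local Notation c := (2 * ln 2 : R).
Let c0 : 0 <= c. Proof. by rewrite mulr_ge0// ln_ge0// ler1n. Qed.

(** The first phase contributes [psi (z + u)], of mean [2 log 2] whatever [z],
    and moves the starting point to [wcum u z], on which the mean of the remaining
    terms does not depend. *)
Lemma expect_surp n z : 0 <= z -> (\int[Q]_a surp n a z = (n%:R * c)%:E)%E.
Proof.
elim: n z => [|n ih] z z0.
  by rewrite mul0r integral0_eq// => a _; rewrite /surp big_ord0.
rewrite (ge0_integral_scons QE); [|exact: measurable_surp1|by move=> a; exact: surp_ge0].
transitivity (\int[U]_u ((n%:R * c)%:E + psi (z + u)%R))%E.
  apply: eq_integral => u _; rewrite -(ih (wcum u z)) ?wcum_ge0// addeC.
  rewrite -integral_prob_cstD ?psi_ge0//.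
  - by apply: eq_integral => a _; rewrite surp_scons.
  - exact: measurable_surp1.
  - by move=> a; exact: surp_ge0.
rewrite integral_prob_cstD; last 3 first.
- by rewrite lee_fin mulr_ge0.
- exact: measurable_psiD.
- by move=> u; exact: psi_ge0.
by rewrite U01_psi// -EFinD -[n.+1%:R]natr1 (mulrDl n%:R) mul1r.
Qed.

Lemma expect_jac n z : 0 <= z -> (\int[Q]_a (jac n a z)%:E = 1)%E.
Proof.
elim: n z => [|n ih] z z0.
  under eq_integral do rewrite /jac big_ord0.
  by rewrite integral_cst//= probability_setT mule1.
rewrite (ge0_integral_scons QE); last 2 first.
- by apply/measurable_EFinP; exact: measurable_jac1.
- by move=> a; rewrite lee_fin jac_ge0.
rewrite -[RHS](U01_weight z0).
apply: eq_integral => u _; rewrite -[RHS]mule1 -(ih (wcum u z)) ?wcum_ge0//.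
rewrite -ge0_integralZl ?lee_fin ?weight_ge0//.
- by apply: eq_integral => a _; rewrite jac_scons EFinM.
- by apply/measurable_EFinP; exact: measurable_jac1.
- by move=> a _; rewrite lee_fin jac_ge0.
Qed.

(** In [w j (psi + s)], where [w] and [psi] belong to the first phase and [j],
    [s] to the others, [j] has mean 1 and [j s] has the mean given by induction;
    the first phase then contributes [int w psi = 2 log 2 - 1]. *)
Lemma expect_jac_surp n z : 0 <= z ->
  (\int[Q]_a ((jac n a z)%:E * surp n a z) = (n%:R * (c - 1))%:E)%E.
Proof.
have d0 : 0 <= c - 1.
  rewrite -lee_fin -(U01_weight_psi (lexx 0)); apply: integral_ge0 => u _.
  by rewrite mule_ge0 ?psi_ge0// lee_fin weight_ge0.
have mjs m y : measurable_fun setT (fun a : @phases R => (jac m a y)%:E * surp m a y)%E.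
  apply: emeasurable_funM; last exact: measurable_surp1.
  by apply/measurable_EFinP; exact: measurable_jac1.
have js0 m (y : R) a : (0 <= (jac m a y)%:E * surp m a y)%E.
  by rewrite mule_ge0 ?surp_ge0// lee_fin jac_ge0.
elim: n z => [|n ih] z z0.
  by rewrite mul0r integral0_eq// => a _; rewrite /surp big_ord0 mule0.
rewrite (ge0_integral_scons QE)//.
transitivity (\int[U]_u ((weight u z)%:E * psi (z + u)%R +
    (n%:R * (c - 1))%:E * (weight u z)%:E))%E.
  apply: eq_integral => u _.
  have w0 : (0 <= (weight u z)%:E)%E by rewrite lee_fin weight_ge0.
  have y0 := wcum_ge0 u z; set y := wcum u z in y0 *.
  have mj : measurable_fun setT (fun a : @phases R => (jac n a y)%:E).
    by apply/measurable_EFinP; exact: measurable_jac1.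
  have j0 a : (0 <= (jac n a y)%:E)%E by rewrite lee_fin jac_ge0.
  have e1 : (\int[Q]_a ((weight u z)%:E * psi (z + u)%R * (jac n a y)%:E) =
      (weight u z)%:E * psi (z + u)%R)%E.
    by rewrite ge0_integralZl ?expect_jac ?mule1// mule_ge0 ?psi_ge0.
  have e2 : (\int[Q]_a ((weight u z)%:E * ((jac n a y)%:E * surp n a y)) =
      (n%:R * (c - 1))%:E * (weight u z)%:E)%E.
    by rewrite ge0_integralZl// ih// muleC.
  rewrite -e1 -e2.
  rewrite -ge0_integralD//; last 4 first.
  - by move=> a _; rewrite !mule_ge0 ?psi_ge0.
  - exact: emeasurable_funM.
  - by move=> a _; rewrite mule_ge0.
  - exact: emeasurable_funM.
  apply: eq_integral => a _; rewrite jac_scons surp_scons EFinM.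
  rewrite ge0_muleDr ?psi_ge0 ?surp_ge0//.
  by congr (_ + _)%E; [exact: muleAC|rewrite muleA].
rewrite ge0_integralD//; last 4 first.
- by move=> u _; rewrite mule_ge0 ?psi_ge0// lee_fin weight_ge0.
- apply: emeasurable_funM; last exact: measurable_psiD.
  by apply/measurable_EFinP; exact: measurable_weightl.
- by move=> u _; rewrite lee_fin mulr_ge0 ?weight_ge0// mulr_ge0.
- apply: emeasurable_funM => //.
  by apply/measurable_EFinP; exact: measurable_weightl.
rewrite U01_weight_psi// ge0_integralZl ?lee_fin ?mulr_ge0//; last 2 first.
- by apply/measurable_EFinP; exact: measurable_weightl.
- by move=> u _; rewrite lee_fin weight_ge0.
by rewrite U01_weight// mule1 -EFinD -[n.+1%:R]natr1 (mulrDl n%:R) mul1r addrC.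
Qed.

(** Expanding [(psi + s)^2]: the mean of [s] does not depend on the first phase,
    so the cross term factors, as it would for independent increments. *)
Lemma expect_surp_sqr n z : 0 <= z ->
  (\int[Q]_a (surp n a z * surp n a z) =
   (n%:R * psi_moment2 + (n%:R ^+ 2 - n%:R) * c ^+ 2)%:E)%E.
Proof.
set V := fun n : nat => n%:R * psi_moment2 + (n%:R ^+ 2 - n%:R) * c ^+ 2 : R.
rewrite -/(V n).
have mss m y : measurable_fun setT (fun a : @phases R => surp m a y * surp m a y)%E.
  by apply: emeasurable_funM; exact: measurable_surp1.
have ss0 m (y : R) a : (0 <= surp m a y * surp m a y :> \bar R)%E.
  by rewrite mule_ge0 ?surp_ge0.
have pp0 (y : R) : (0 <= psi y * psi y :> \bar R)%E by rewrite mule_ge0 ?psi_ge0.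
elim: n z => [|n ih] z z0.
  rewrite /V mul0r expr0n subrr mul0r addr0.
  by rewrite integral0_eq// => a _; rewrite /surp big_ord0 mule0.
have V0 : (0 <= (V n)%:E)%E by rewrite -(ih 0)//; apply: integral_ge0.
rewrite (ge0_integral_scons QE)//.
transitivity (\int[U]_u ((V n)%:E + (psi (z + u)%R * psi (z + u)%R +
    (2 * (n%:R * c))%:E * psi (z + u)%R)))%E.
  apply: eq_integral => u _.
  have w0 := wcum_ge0 u z; set y := wcum u z in w0 *; set p := psi (z + u)%R.
  have p0 : (0 <= p)%E by exact: psi_ge0.
  transitivity (\int[Q]_a (p * p + (surp n a y * surp n a y +
      (2%:E * p) * surp n a y)))%E.
    apply: eq_integral => a _; rewrite surp_scons -/p -/y.
    have s0 := surp_ge0 n a y; set s := surp n a y in s0 *.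
    rewrite ge0_muleDl ?adde_ge0// !ge0_muleDr// -addeA; congr (_ + _)%E.
    rewrite (muleC s p) addeA addeC; congr (_ + _)%E.
    by rewrite -muleA [in RHS](_ : 2%:E = 1 + 1)%E// ge0_muleDl ?mule_ge0// !mul1e.
  rewrite integral_prob_cstD; last 3 first.
  - by rewrite mule_ge0.
  - apply: emeasurable_funD => //; apply: emeasurable_funM => //.
    exact: measurable_surp1.
  - by move=> a; rewrite adde_ge0// mule_ge0 ?surp_ge0// mule_ge0.
  rewrite ge0_integralD//; last 2 first.
  - by move=> a _; rewrite mule_ge0 ?surp_ge0// mule_ge0.
  - by apply: emeasurable_funM => //; exact: measurable_surp1.
  rewrite ge0_integralZl//; last 3 first.
  - exact: measurable_surp1.
  - by move=> a _; exact: surp_ge0.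
  - by rewrite mule_ge0.
  rewrite ih// expect_surp// addeCA; congr (_ + (_ + _))%E.
  by rewrite EFinM muleAC.
have mp := measurable_psiD z.
have mpp : measurable_fun setT (fun u : R => psi (z + u)%R * psi (z + u)%R)%E.
  exact: emeasurable_funM.
have k0 : 0 <= 2 * (n%:R * c) by rewrite mulr_ge0// mulr_ge0.
rewrite integral_prob_cstD//; last 2 first.
- by apply: emeasurable_funD => //; exact: emeasurable_funM.
- by move=> u; rewrite adde_ge0// mule_ge0 ?psi_ge0.
rewrite ge0_integralD//; last 2 first.
- by move=> u _; rewrite mule_ge0 ?psi_ge0.
- exact: emeasurable_funM.
rewrite ge0_integralZl//; last by move=> u _; exact: psi_ge0.
rewrite U01_psi_sqr// U01_psi// -EFinM -!EFinD; congr EFin.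
by rewrite /V -[n.+1%:R]natr1; ring.
Qed.

End expectations.

(** * Transport of a density by its distribution function *)

Section measure_of_density.
Context d (T : measurableType d) (R : realType).
Variables (mu : {measure set T -> \bar R}) (g : T -> \bar R).

(** The measure with density [g].  The proofs that [g] is measurable and
    nonnegative are arguments so that the measure structure can be inferred from
    the term. *)
Definition density_measure (_ : measurable_fun setT g)
    (_ : forall x, (0 <= g x)%E) (A : set T) : \bar R :=
  (\int[mu]_(x in A) g x)%E.

Hypotheses (mg : measurable_fun setT g) (g0 : forall x, (0 <= g x)%E).

Local Notation nu := (density_measure mg g0).

Let nu0 : nu set0 = 0%E. Proof. by rewrite /density_measure integral_set0. Qed.

Let nu_ge0 A : (0 <= nu A)%E. Proof. exact: integral_ge0. Qed.

HB.instance Definition _ := isMeasure.Build _ _ _ nu nu0 nu_ge0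
  (semi_sigma_additive_nng_induced mg g0).

End measure_of_density.

Section layer_cake_formula.
Context {R : realType}.
Notation leb := (@lebesgue_measure R).

Lemma layer_cake (y : \bar R) : (0 <= y)%E ->
  (y = \int[leb]_s (if (0 <= s)%R && (s%:E < y) then 1 else 0))%E.
Proof.
have E (J : set R) : (forall s : R, (s \in J) = (0 <= s) && (s%:E < y)%E) ->
    measurable J ->
    (\int[leb]_s (if (0 <= s)%R && (s%:E < y) then 1 else 0) = leb J)%E.
  move=> JE mJ; rewrite -[J in RHS]setIT -(@integral_indic _ _ _ leb setT measurableT J mJ).
  by apply: eq_integral => s _; rewrite -JE indicE; case: (s \in J).
case: y E => [r||//] E y0.
- rewrite (E `[0, r[%classic)//; last first.
    by move=> s; apply/idP/idP; rewrite inE/= in_itv/= lte_fin.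
  rewrite /= lebesgue_measure_itv/= lte_fin; case: ltP => r0.
    by rewrite -EFinB subr0.
  by congr EFin; apply/eqP; rewrite eq_le r0 -lee_fin.
- rewrite (E `[0, +oo[%classic)//; last first.
    by move=> s; apply/idP/idP; rewrite inE/= in_itv/= ltry.
  by rewrite /= lebesgue_measure_itv/= ltry.
Qed.

(** The layer cake formula and Tonelli's theorem.  It reduces the change of
    variables below to measures of sets. *)
Lemma integral_layers d (T : measurableType d)
    (mu : {sigma_finite_measure set T -> \bar R}) (g h : T -> \bar R) :
  measurable_fun setT g -> (forall x, (0 <= g x)%E) ->
  measurable_fun setT h -> (forall x, (0 <= h x)%E) ->
  (\int[mu]_x (g x * h x) = \int[leb]_s
    (if (0 <= s)%R then \int[mu]_(x in [set x | s%:E < h x]) g x else 0))%E.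
Proof.
move=> mg g0 mh h0.
pose I (x : T) (s : R) : \bar R :=
  if (0 <= s)%R && (s%:E < h x)%E then 1%E else 0%E.
have I0 x s : (0 <= I x s)%E by rewrite /I; case: ifP.
have mI : measurable_fun setT (fun p : T * R => I p.1 p.2).
  apply: measurable_fun_ifT => //; apply: measurable_and.
    exact: measurable_fun_ler.
  apply: measurable_fun_lte; first exact/measurable_EFinP.
  exact: (measurableT_comp mh measurable_fst).
transitivity (\int[mu]_x \int[leb]_s (g x * I x s))%E.
  apply: eq_integral => x _; rewrite {1}(layer_cake (h0 x)) ge0_integralZl//.
  exact: (measurableT_comp mI (measurable_pair1 x)).
have mgI : measurable_fun setT (fun p : T * R => g p.1 * I p.1 p.2)%E.
  apply: emeasurable_funM => //.
  exact: (measurableT_comp mg measurable_fst).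
have gI0 (p : T * R) : (0 <= g p.1 * I p.1 p.2)%E by rewrite mule_ge0.
rewrite (@fubini_tonelli _ _ _ _ _ mu leb _ mgI gI0) /=.
apply: eq_integral => s _; rewrite /I; case: ifPn => s0; last first.
  by apply: integral0_eq => x _; rewrite mule0.
rewrite [RHS]integral_mkcond; apply: eq_integral => x _; rewrite patchE /=.
have -> : (x \in [set x | s%:E < h x]%E) = (s%:E < h x)%E.
  by apply/idP/idP; rewrite inE.
by case: ifP; rewrite ?mule1 ?mule0.
Qed.

End layer_cake_formula.

Section density.
Context {R : realType}.
Notation mu := (@lebesgue_measure R).
Notation U := (uniform_prob (@ltr01 R)).
Variables (f : R -> R).
Hypothesis hf : Dplus f.
Local Notation F := (distr_fun f).

Lemma density_ge0 x : 0 <= f x.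
Proof.
have [_ [I [_ _ _ fp f0]]] := hf.
by have [/fp/ltW//|/f0 ->] := pselect (I x).
Qed.

Lemma measurable_density : measurable_fun setT f.
Proof.
have [_ [I [oI _ cf _ f0]]] := hf.
have -> : f = f \_ I.
  by apply/funext => x; rewrite patchE; case: ifPn => //; rewrite notin_setE => /f0.
apply/(measurable_restrictT _ _).1; first exact: open_measurable.
by apply: subspace_continuous_measurable_fun => //; exact: open_measurable.
Qed.

Let mf : measurable_fun setT (EFin \o f).
Proof. by apply/measurable_EFinP; exact: measurable_density. Qed.

Let f0 x : (0 <= (f x)%:E)%E. Proof. by rewrite lee_fin density_ge0. Qed.

Lemma density_integrable (A : set R) : measurable A ->
  mu.-integrable A (EFin \o f).
Proof.
move=> mA; apply: (@integrableS _ _ _ mu setT) => //.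
apply/integrableP; split => //.
have [f1 _] := hf; rewrite (_ : (\int[mu]_x _)%E = 1%E) ?ltry// -f1.
by apply: eq_integral => x _; rewrite gee0_abs ?f0.
Qed.

Lemma distr_funE x : ((F x)%:E = \int[mu]_(y in `]-oo, x]) (f y)%:E)%E.
Proof.
rewrite /distr_fun /Rintegral fineK//.
by apply: integrable_fin_num => //; exact: density_integrable.
Qed.

Lemma distr_funD x y : x <= y ->
  ((F y)%:E = (F x)%:E + \int[mu]_(t in `]x, y]) (f t)%:E)%E.
Proof.
move=> xy; rewrite !distr_funE -ge0_integral_setU//=; last 2 first.
- exact: measurable_funTS.
- apply/disj_setPS => t [] /=; rewrite !in_itv/= => tx /andP[xt _].
  by move: xt; rewrite ltNge tx.
congr (integral _ _ _); apply/seteqP; split => t /=; rewrite !in_itv/=.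
  by move=> ty; case: (leP t x) => tx; [left|right].
by move=> [tx|/andP[]//]; exact: le_trans xy.
Qed.

Lemma distr_fun_ge0 x : 0 <= F x.
Proof. by rewrite -lee_fin distr_funE; exact: integral_ge0. Qed.

Lemma distr_fun_homo x y : x <= y -> F x <= F y.
Proof. by move=> xy; rewrite -lee_fin (distr_funD xy) leeDl// integral_ge0. Qed.

Lemma distr_funC x : (1 = (F x)%:E + \int[mu]_(t in `]x, +oo[) (f t)%:E)%E.
Proof.
have [<- _] := hf; rewrite distr_funE -ge0_integral_setU//=; last 2 first.
- exact: measurable_funTS.
- apply/disj_setPS => t [] /=; rewrite !in_itv/= andbT => tx xt.
  by move: xt; rewrite ltNge tx.
congr (integral _ _ _); apply/seteqP; split => t //= _; rewrite !in_itv/= andbT.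
by case: (leP t x) => tx; [left|right].
Qed.

(** A positive value of the continuous density keeps it bounded away from [0]
    on a whole interval, which then carries positive mass. *)
Lemma distr_fun_lt x y : x < y -> 0 < f y -> F x < F y.
Proof.
move=> xy fy; have [_ [I [oI _ cf fp fz]]] := hf.
have Iy : I y by apply: contrapT => /fz fy0; rewrite fy0 ltxx in fy.
have cfy : {for y, continuous f}.
  by move: cf; rewrite continuous_open_subspace// => /(_ y); apply; rewrite inE.
have : \forall t \near y, f y / 2 < f t.
  by apply: cvgr_gt cfy _ _; rewrite ltr_pdivrMr// ltr_pMr// ltr1n.
move=> [e /= e0 He].
pose z := Num.max x (y - e / 2).
have zy : z < y by rewrite gt_max xy ltrBlDr ltrDl divr_gt0.
have xz : x <= z by rewrite le_max lexx.
apply: (le_lt_trans (distr_fun_homo xz)).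
rewrite -lte_fin (distr_funD (ltW zy)) lteDl//.
apply: (@lt_le_trans _ _ (\int[mu]_(t in `]z, y]) (cst (f y / 2)%:E t))%E).
  rewrite integral_cst//= lebesgue_measure_itv/= lte_fin zy -EFinB -EFinM lte_fin.
  by rewrite mulr_gt0 ?divr_gt0// subr_gt0.
apply: ge0_le_integral => //.
- by move=> t _; rewrite lee_fin divr_ge0// ltW.
- exact: measurable_funTS.
- move=> t; rewrite /= in_itv/= => /andP[zt ty]; rewrite lee_fin ltW//.
  apply: He; rewrite /ball/= ger0_norm ?subr_ge0//.
  have : y - e / 2 < t by apply: le_lt_trans zt; rewrite le_max lexx orbT.
  by move: e0; lra.
Qed.

Lemma distr_fun_gt0 x : 0 < f x -> 0 < F x.
Proof.
move=> fx; apply: (@le_lt_trans _ _ (F (x - 1))); first exact: distr_fun_ge0.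
by apply: distr_fun_lt fx; rewrite ltrBlDr ltrDl.
Qed.

Local Notation nu := (density_measure mu mf f0).

(** The limits of [F] at infinity are those of the measure with density [f] along
    half-lines; in between, the intermediate value theorem applies because an
    indefinite integral is continuous. *)
Lemma distr_fun_surj t : 0 < t < 1 -> exists x, F x = t.
Proof.
move=> /andP[t0 t1].
have [a Fa] : exists a, F a < t.
  have : (nu \o (fun n => `]-oo, (- n%:R)%R]%classic)) n @[n --> \oo] --> nu set0.
    have <- : \bigcap_n `]-oo, (- n%:R : R)%R]%classic = set0.
      rewrite -subset0 => s /(_ (Num.truncn (- s)).+1 I).
      by rewrite /= in_itv/= leNgt => /negP; apply; rewrite ltrNl truncnS_gt.
    apply: nonincreasing_cvg_mu => //.
    - by rewrite /= /density_measure -distr_funE ltry.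
    - exact: bigcap_measurable.
    - move=> m n mn; apply/subsetPset => s/=; rewrite !in_itv => /le_trans; apply.
      by rewrite lerN2 ler_nat.
  rewrite measure0 => /fine_cvg h.
  have h' : F (- n%:R) @[n --> \oo] --> (0 : R) := h.
  have [n _ /(_ n (leqnn n)) Fn] := cvgr_lt _ h' _ t0.
  by exists (- n%:R).
have [b Fb] : exists b, t < F b.
  have : (nu \o (fun n => `]-oo, (n%:R)%R]%classic)) n @[n --> \oo] --> nu setT.
    have <- : \bigcup_n `]-oo, (n%:R : R)%R]%classic = setT.
      rewrite -subTset => s _.
      by exists (Num.truncn s).+1; rewrite //= in_itv/= ltW// truncnS_gt.
    apply: nondecreasing_cvg_mu => //; first exact: bigcup_measurable.
    move=> n m nm; apply/subsetPset => s/=; rewrite !in_itv/= => /le_trans.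
    by apply; rewrite ler_nat.
  have -> : nu setT = 1%E by have [<- _] := hf.
  move=> /fine_cvg h.
  have h' : F n%:R @[n --> \oo] --> (1 : R) := h.
  have [n _ /(_ n (leqnn n)) Fn] := cvgr_gt _ h' _ t1.
  by exists n%:R.
have ab : a <= b.
  by rewrite leNgt; apply/negP => /ltW/distr_fun_homo; rewrite leNgt (lt_trans Fa).
have if_ : mu.-integrable `[a, b] (EFin \o f) by exact: density_integrable.
have GE x : a <= x -> F x = F a + parameterized_integral mu a x f.
  move=> ax; apply: EFin_inj; rewrite (distr_funD ax) EFinD; congr (_ + _)%E.
  rewrite /parameterized_integral /Rintegral fineK; last first.
    by apply: integrable_fin_num => //; exact: density_integrable.
  by rewrite integral_itv_obnd_cbnd//; exact: measurable_funTS.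
have [|x] := IVT (v := t - F a) ab (parameterized_integral_continuous ab if_).
  have := GE _ ab; have := GE _ (lexx a).
  have := distr_fun_homo ab.
  set p := parameterized_integral _ _ _ _; set q := parameterized_integral _ _ _ _.
  by move=> h ha hb; rewrite min_l ?max_r; lra.
by rewrite in_itv/= => /andP[ax _] Gx; exists x; rewrite GE// Gx subrKC.
Qed.

Lemma measurable_distr_fun : measurable_fun setT F.
Proof. by apply: nondecreasing_measurable => // x y; exact: distr_fun_homo. Qed.

Lemma U01E (B : set R) : measurable B -> U B = mu (B `&` `]0, 1[%classic).
Proof.
move=> mB; rewrite -(@integral_indic _ _ _ mu `]0, 1[%classic)//.
rewrite -integral_U01//; last by apply/measurable_EFinP; exact: measurable_indic.
by rewrite integral_indic// setIT.
Qed.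

Lemma density_zero_of_distr_fun_le x0 x : x0 < x -> F x <= F x0 -> f x = 0.
Proof.
move=> x0x Fx; apply/eqP; rewrite eq_le density_ge0 andbT leNgt; apply/negP.
by move=> /(distr_fun_lt x0x); rewrite ltNge Fx.
Qed.

Lemma distr_fun_le1 x : F x <= 1.
Proof. by rewrite -lee_fin [leRHS](distr_funC x) leeDl// integral_ge0. Qed.

(** It suffices to compare both measures on the half-lines [t < z].  For [t] in
    the open unit interval, [t = F x0], and [t < F x] differs from [x0 < x] only
    where [F] is constant to the right of [x0], that is, where [f] vanishes. *)
Lemma distr_fun_law (B : set R) : measurable B ->
  (\int[mu]_(x in F @^-1` B) (f x)%:E = U B)%E.
Proof.
move=> mB.
have mF : measurable_fun setT (F : measurableTypeR R -> measurableTypeR R).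
  exact: measurable_distr_fun.
pose m := measure_function_pushforward__canonical__measure_function_Measure nu mF.
suff : m B = U B by [].
apply: (@measure_unique _ R (measurableTypeR R) (@RGenOInfty.G R)
  (fun n => `](- n%:R), +oo[%classic) _ _ _ _ m U) => //.
- exact: RGenOInfty.measurableE.
- move=> _ _ [x ->] [y ->]; exists (Num.max x y).
  apply/seteqP; split => z /=; rewrite !in_itv/= !andbT gt_max.
    by move=> [-> ->].
  by move=> /andP[-> ->].
- by move=> n; exists (- n%:R).
- apply/seteqP; split => // x _; exists (Num.truncn (- x)).+1 => //=.
  by rewrite in_itv/= andbT ltrNl truncnS_gt.
- move=> _ [t ->]; rewrite [RHS]U01E//.
  change ((\int[mu]_(x in F @^-1` `]t, +oo[) (f x)%:E)%E = mu (`]t, +oo[ `&` `]0, 1[)%classic).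
  have [t0|t0] := ltP t 0.
    have -> : F @^-1` `]t, +oo[ = setT.
      apply/seteqP; split => // x _; rewrite /= in_itv/= andbT.
      exact: lt_le_trans (distr_fun_ge0 x).
    have -> : `]t, +oo[ `&` `]0, 1[ = `]0, 1[%classic :> set R.
      apply/seteqP; split => x /=; first by case.
      rewrite !in_itv/= andbT => /andP[x0 x1].
      by rewrite (lt_trans t0 x0) x0 x1.
    by have [-> _] := hf; rewrite lebesgue_measure_itv/= lte_fin ltr01 -EFinB subr0.
  have [t1|t1] := leP 1 t.
    have -> : F @^-1` `]t, +oo[ = set0.
      rewrite -subset0 => x; rewrite /= in_itv/= andbT => /(le_lt_trans t1).
      by rewrite ltNge distr_fun_le1.
    have -> : `]t, +oo[ `&` `]0, 1[ = set0 :> set R.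
      rewrite -subset0 => x [] /=; rewrite !in_itv/= andbT => tx /andP[_ x1].
      by move: (lt_trans x1 (le_lt_trans t1 tx)); rewrite ltxx.
    by rewrite integral_set0 measure0.
  have -> : `]t, +oo[ `&` `]0, 1[ = `]t, 1[%classic :> set R.
    apply/seteqP; split => x /=; rewrite !in_itv/= andbT.
      by move=> [-> /andP[_ ->]].
    by move=> /andP[tx ->]; rewrite tx (le_lt_trans t0).
  rewrite lebesgue_measure_itv/= lte_fin t1 -EFinB.
  move: t0; rewrite le_eqVlt => /predU1P[<-|t0].
    rewrite subr0; have [<- _] := hf.
    rewrite integral_mkcond; apply: eq_integral => x _; rewrite patchE.
    case: ifPn => //; rewrite notin_setE /= in_itv/= andbT => Fx.
    have [fx|] := ltP 0 (f x); first by have := distr_fun_gt0 fx.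
    by move=> fx; congr EFin; apply/eqP; rewrite eq_le fx density_ge0.
  have [|x0 Fx0] := distr_fun_surj (t := t); first by rewrite t0.
  have -> : ((1 - t)%:E = \int[mu]_(x in `]x0, +oo[) (f x)%:E)%E.
    by rewrite EFinB {1}(distr_funC x0) -Fx0 addeAC subee// add0e.
  rewrite integral_mkcond [RHS]integral_mkcond; apply: eq_integral => x _.
  rewrite !patchE; case: ifPn; case: ifPn => //; rewrite notin_setE ?inE /= !in_itv/= !andbT.
    by move=> /negP; rewrite -leNgt => /distr_fun_homo; rewrite Fx0 leNgt => /negbTE ->.
  move=> x0x /negP; rewrite -leNgt -Fx0 => Fx.
  by rewrite (density_zero_of_distr_fun_le x0x Fx).
- move=> k; apply: (@le_lt_trans _ _ (nu setT)).
    apply: ge0_subset_integral => //.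
      by rewrite -[X in _.-measurable X]setTI; exact: measurable_distr_fun.
    by move=> x _; exact: f0.
  by rewrite /density_measure; have [-> _] := hf; rewrite ltry.
Qed.

(** Both integrals are decomposed into the superlevel sets of [k], on which
    [distr_fun_law] applies. *)
Lemma integral_distr_fun (k : R -> \bar R) : measurable_fun setT k ->
  (forall z, (0 <= k z)%E) ->
  (\int[mu]_x ((f x)%:E * k (F x)) = \int[U]_z k z)%E.
Proof.
move=> mk k0.
have mkF : measurable_fun setT (k \o F).
  exact: (measurableT_comp mk measurable_distr_fun).
rewrite (@integral_layers _ _ _ mu _ (k \o F) mf f0 mkF); last first.
  by move=> x; exact: k0.
have h := @integral_layers R _ _ U (cst 1%E) k
  (@measurable_cst _ _ _ _ _ _) (fun=> @lee01 R) mk k0.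
transitivity (\int[U]_z (cst 1 z * k z))%E; last first.
  by apply: eq_integral => z _; rewrite mul1e.
rewrite h {h}; apply: eq_integral => s _.
case: ifP => // s0.
have mS : measurable [set z | s%:E < k z]%E.
  by rewrite -[X in measurable X]setTI; exact: emeasurable_fun_o_infty.
rewrite [RHS](_ : _ = U [set z | s%:E < k z]%E); last first.
  by rewrite (integral_cst U mS 1%E) mul1e.
by rewrite -distr_fun_law.
Qed.

End density.

(** * The strong law *)

Section averages.
Context {R : realType}.

(** If [k^2 <= n < (k+1)^2], then [u n / n] lies between [u (k^2) / (k+1)^2] and
    [u ((k+1)^2) / k^2], and the ratio of consecutive squares tends to 1. *)
Lemma cvg_average_of_squares (u : nat -> R) (c : R) :
  (forall m n, (m <= n)%N -> u m <= u n) -> (forall n, 0 <= u n) ->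
  u (k.+1 ^ 2)%N / (k.+1 ^ 2)%:R @[k --> \oo] --> c ->
  u n / n%:R @[n --> \oo] --> c.
Proof.
move=> u_homo u0 uc.
pose s (n : nat) : nat := Num.truncn (Num.sqrt n%:R : R).
have sP n : (s n ^ 2 <= n < (s n).+1 ^ 2)%N.
  have /andP[h1 h2] := truncn_itv (sqrtr_ge0 (n%:R : R)).
  rewrite -/(s n) in h1 h2.
  have e : Num.sqrt n%:R ^+ 2 = n%:R :> R by rewrite sqr_sqrtr.
  rewrite -(ler_nat R) -(ltr_nat R) !natrX -e.
  by rewrite lerXn2r ?nnegrE ?sqrtr_ge0//= ltrXn2r ?nnegrE ?sqrtr_ge0.
pose r (k : nat) := u (k ^ 2)%N / (k ^ 2)%:R.
pose q (k : nat) : R := (k.+2%:R / k.+1%:R) ^+ 2.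
have q1 : q k @[k --> \oo] --> (1 : R).
  have : (1 + harmonic k) @[k --> \oo] --> (1 + 0 : R).
    by apply: cvgD; [exact: cvg_cst|exact: cvg_harmonic].
  rewrite addr0 => h; rewrite -[X in _ --> X](mulr1 1).
  rewrite (_ : (fun k => q k) = fun k => (1 + harmonic k) * (1 + harmonic k)).
    exact: cvgM.
  apply/funext => k; rewrite /q expr2 /harmonic.
  have -> : k.+2%:R / k.+1%:R = 1 + k.+1%:R^-1 :> R.
    by rewrite -[k.+2%:R]natr1 mulrDl mulfV ?mul1r// pnatr_eq0.
  by [].
have rS : r k.+1 @[k --> \oo] --> c by exact: uc.
have rSS : r k.+2 @[k --> \oo] --> c by rewrite (cvg_shiftS (r \o S)).
have lo : r k.+1 / q k @[k --> \oo] --> c.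
  by rewrite -[X in _ --> X]divr1; apply: cvgM => //; apply: cvgV.
have hi : r k.+2 * q k @[k --> \oo] --> c.
  by rewrite -[X in _ --> X]mulr1; apply: cvgM.
have scvg : (s n.+1).-1 @[n --> \oo] --> \oo.
  apply/cvgnyPge => A; near=> n.
  have /andP[_ h] := sP n.+1.
  have : ((A.+2) ^ 2 <= n)%N by near: n; exact: nbhs_infty_ge.
  move=> An; have : (A.+2 < (s n.+1).+1)%N.
    by rewrite -(ltn_exp2r _ _ (isT : (0 < 2)%N)) (leq_ltn_trans _ h)// (leq_trans An).
  by case: (s n.+1) => //= m; rewrite !ltnS => /ltnW; exact: leq_trans.
have s0 n : (0 < s n.+1)%N.
  have /andP[_ h] := sP n.+1; case: (s n.+1) h => //.
rewrite -cvg_shiftS.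
apply: (@squeeze_cvgr _ _ _ _ ((fun k => r k.+1 / q k) \o (fun n => (s n.+1).-1))
    ((fun k => r k.+2 * q k) \o (fun n => (s n.+1).-1))).
- near=> n => /=; have /andP[h1 h2] := sP n.+1; have s1 := s0 n.
  rewrite prednK//; case: (s n.+1) s1 h1 h2 => // k _ h1 h2 /=.
  have k0 : 0 < k.+1%:R :> R by rewrite ltr0n.
  have kk0 : 0 < k.+2%:R :> R by rewrite ltr0n.
  have n0 : 0 < n.+1%:R :> R by rewrite ltr0n.
  have -> : r k.+1 / q k = u (k.+1 ^ 2)%N / (k.+2 ^ 2)%:R.
    rewrite /r /q !natrX; field.
    by rewrite !gt_eqF.
  have -> : r k.+2 * q k = u (k.+2 ^ 2)%N / (k.+1 ^ 2)%:R.
    rewrite /r /q !natrX; field.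
    by rewrite !gt_eqF.
  apply/andP; split.
    apply: ler_pM => //; [exact: u_homo|].
    by rewrite lef_pV2 ?posrE ?ltr0n ?expn_gt0// ler_nat ltnW.
  apply: ler_pM => //; first by apply: u_homo; exact: ltnW.
  by rewrite lef_pV2 ?posrE ?ltr0n ?expn_gt0// ler_nat.
- exact: (cvg_comp _ _ scvg lo).
- exact: (cvg_comp _ _ scvg hi).
Unshelve. all: by end_near. Qed.

(** Telescoping gives [1 + 1/4 + ... + 1/m^2 <= 2 - 1/m]. *)
Lemma nneseries_inv_squares_fin (v : R) : 0 <= v ->
  (\sum_(0 <= k <oo) (v / (k.+1 ^ 2)%:R)%:E < +oo)%E.
Proof.
move=> v0; apply: (@le_lt_trans _ _ (v * 2)%:E); last exact: ltry.
apply: lime_le.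
  by apply: is_cvg_nneseries => n _ _; rewrite lee_fin divr_ge0.
apply: nearW => n; rewrite sumEFin lee_fin -mulr_sumr ler_wpM2l//.
have h m : \sum_(0 <= k < m.+1) (k.+1 ^ 2)%:R^-1 <= 2 - m.+1%:R^-1 :> R.
  elim: m => [|m ih]; first by rewrite big_nat1 exp1n invr1; lra.
  rewrite big_nat_recr//=; apply: (le_trans (lerD ih (lexx _))).
  have m0 : 0 < m.+1%:R :> R by rewrite ltr0n.
  rewrite natrX -[m.+2%:R]natr1; move: m0; move: (m.+1%:R : R) => x x0.
  rewrite -subr_ge0 (_ : _ - _ = (x * (x + 1) ^+ 2)^-1); last by field; lra.
  by rewrite invr_ge0 mulr_ge0 ?sqr_ge0// ltW.
case: n => [|n]; first by rewrite big_geq.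
by apply: (le_trans (h n)); rewrite gerBl.
Qed.

End averages.

Section strong_law.
Context {R : realType}.
Notation U := (uniform_prob (@ltr01 R)).
Variable Q : probability (@phases R) R.
Hypothesis QE : forall n B, (forall j, measurable (B j)) ->
  Q (box n B) = (\prod_(j < n) U (B j))%E.
Local Notation c := (2 * ln 2 : R).

Lemma integral_U01_cst (g : R -> \bar R) (r : \bar R) : measurable_fun setT g ->
  (forall z, (0 <= g z)%E) -> (forall z, 0 < z < 1 -> g z = r) ->
  (\int[U]_z g z = r)%E.
Proof.
move=> mg g0 gr; rewrite integral_U01//.
rewrite (eq_integral (cst r)); last by move=> z; rewrite inE/= in_itv/= => /gr.
rewrite integral_cst//.
by rewrite /= lebesgue_measure_itv/= lte_fin ltr01 -EFinB subr0 mule1.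
Qed.

(** The order of the two averages is exchanged, after which the inner one is
    constant in the starting point. *)
Lemma expect_average (H : phases -> R -> \bar R) (r : \bar R) :
  measurable_fun setT (fun p : phases * R => H p.1 p.2) ->
  (forall a z, (0 <= H a z)%E) ->
  (forall z : R, (0 <= z)%R -> \int[Q]_a H a z = r)%E ->
  (\int[Q]_a \int[U]_z H a z = r)%E.
Proof.
move=> mH H0 Hr.
have H0' (p : phases * R) : (0 <= H p.1 p.2)%E by exact: H0.
rewrite (@fubini_tonelli _ _ _ _ _ Q U _ mH H0') /=.
apply: integral_U01_cst.
- exact: (@measurable_fun_fubini_tonelli_G _ _ _ _ _ Q _ mH H0').
- by move=> z; apply: integral_ge0 => a _; exact: H0.
- by move=> z /andP[/ltW z0 _]; exact: Hr.
Qed.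

(** As a function of the phases, this is [D(f || f_n) + n log 2]. *)
Definition mean_surp n (a : @phases R) : \bar R := (\int[U]_z surp n a z)%E.

Lemma mean_surp_ge0 n a : (0 <= mean_surp n a)%E.
Proof. by apply: integral_ge0 => z _; exact: surp_ge0. Qed.

Lemma measurable_surp2 n (a : @phases R) : measurable_fun setT (fun z => surp n a z).
Proof. exact: (measurableT_comp (measurable_surp n) (measurable_pair1 a)). Qed.

Lemma measurable_mean_surp n : measurable_fun setT (mean_surp n).
Proof.
apply: (@measurable_fun_fubini_tonelli_F _ _ _ _ _ U
  (fun p : @phases R * R => surp n p.1 p.2)).
- exact: measurable_surp.
- by move=> p; exact: surp_ge0.
Qed.

Lemma mean_surp_homo a m n : (m <= n)%N -> (mean_surp m a <= mean_surp n a)%E.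
Proof.
move=> mn; apply: ge0_le_integral => //.
- by move=> z _; exact: surp_ge0.
- exact: measurable_surp2.
- exact: measurable_surp2.
- move=> z _; rewrite /surp.
  rewrite -(big_mkord xpredT (fun j => psi (wcomp a j z + a j)%R)).
  rewrite -(big_mkord xpredT (fun j => psi (wcomp a j z + a j)%R)).
  rewrite (big_cat_nat (leq0n m) mn)/= leeDl//.
  by apply: sume_ge0 => j _; exact: psi_ge0.
Qed.

Definition sqdev n (a : @phases R) z : \bar R :=
  ((surp n a z - (n%:R * c)%:E) * (surp n a z - (n%:R * c)%:E))%E.

Lemma sqdev_ge0 n a z : (0 <= sqdev n a z)%E.
Proof. exact: sqre_ge0. Qed.

Lemma measurable_sqdev n :
  measurable_fun setT (fun p : @phases R * R => sqdev n p.1 p.2).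
Proof.
have m1 : measurable_fun setT
    (fun p : @phases R * R => surp n p.1 p.2 - (n%:R * c)%:E)%E.
  by apply: emeasurable_funB => //; exact: measurable_surp.
exact: emeasurable_funM.
Qed.

(** The expansion of a square, written without subtraction so that it holds also
    where [surp] is infinite. *)
Lemma sqdevE n a z : (sqdev n a z + (2 * (n%:R * c))%:E * surp n a z =
  surp n a z * surp n a z + ((n%:R * c) ^+ 2)%:E)%E.
Proof.
have m0 : 0 <= n%:R * c by rewrite mulr_ge0// mulr_ge0// ln_ge0// ler1n.
rewrite /sqdev; move: (surp_ge0 n a z) m0; move: (surp n a z) (n%:R * c) => k m.
case: k => [k||]// k0 m0.
  by rewrite -EFinB -!EFinM -!EFinD; congr EFin; ring.
have -> : (+oo - m%:E = +oo)%E by rewrite addye.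
rewrite mulyy [RHS]addye// addye//.
by rewrite gt_eqF// (lt_le_trans (ltNyr 0))// mule_ge0// lee_fin mulr_ge0.
Qed.

Lemma expect_sqdev n z : 0 <= z ->
  (\int[Q]_a sqdev n a z = (n%:R * (psi_moment2 - c ^+ 2))%:E)%E.
Proof.
move=> z0.
have m0 : 0 <= n%:R * c by rewrite mulr_ge0// mulr_ge0// ln_ge0// ler1n.
have ms : measurable_fun setT (fun a => sqdev n a z).
  exact: (measurableT_comp (measurable_sqdev n) (measurable_pair2 z)).
have mk := @measurable_surp1 R n z.
have : (\int[Q]_a (sqdev n a z + (2 * (n%:R * c))%:E * surp n a z) =
    \int[Q]_a (surp n a z * surp n a z + ((n%:R * c) ^+ 2)%:E))%E.
  by apply: eq_integral => a _; exact: sqdevE.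
have m20 : (0 <= (2 * (n%:R * c))%:E)%E by rewrite lee_fin mulr_ge0.
rewrite ge0_integralD//; last 3 first.
- by move=> a _; exact: sqdev_ge0.
- by move=> a _; rewrite mule_ge0 ?surp_ge0.
- exact: emeasurable_funM.
rewrite ge0_integralD//; last 3 first.
- by move=> a _; rewrite mule_ge0 ?surp_ge0.
- exact: emeasurable_funM.
- by move=> a _; rewrite lee_fin sqr_ge0.
rewrite ge0_integralZl//; last by move=> a _; exact: surp_ge0.
rewrite expect_surp// expect_surp_sqr// integral_cst//= probability_setT mule1.
have : (0 <= \int[Q]_a sqdev n a z)%E.
  by apply: integral_ge0 => a _; exact: sqdev_ge0.
case: (\int[Q]_a sqdev n a z)%E => [x||]// _.
by rewrite -EFinM -!EFinD => -[h]; congr EFin; nra.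
Qed.

Definition mean_sqdev n (a : @phases R) : \bar R := (\int[U]_z sqdev n a z)%E.

Lemma mean_sqdev_ge0 n a : (0 <= mean_sqdev n a)%E.
Proof. by apply: integral_ge0 => z _; exact: sqdev_ge0. Qed.

Lemma measurable_mean_sqdev n : measurable_fun setT (mean_sqdev n).
Proof.
apply: (@measurable_fun_fubini_tonelli_F _ _ _ _ _ U
  (fun p : @phases R * R => sqdev n p.1 p.2)).
- exact: measurable_sqdev.
- by move=> p; exact: sqdev_ge0.
Qed.

Lemma expect_mean_sqdev n :
  (\int[Q]_a mean_sqdev n a = (n%:R * (psi_moment2 - c ^+ 2))%:E)%E.
Proof.
apply: expect_average.
- exact: measurable_sqdev.
- by move=> a z; exact: sqdev_ge0.
- by move=> z; exact: expect_sqdev.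
Qed.

Lemma expect_mean_surp n : (\int[Q]_a mean_surp n a = (n%:R * c)%:E)%E.
Proof.
apply: expect_average.
- exact: measurable_surp.
- by move=> a z; exact: surp_ge0.
- by move=> z; exact: expect_surp.
Qed.

Lemma variance_ge0 : 0 <= psi_moment2 - c ^+ 2.
Proof.
rewrite -[leRHS]mul1r -lee_fin -(expect_mean_sqdev 1).
by apply: integral_ge0 => a _; exact: mean_sqdev_ge0.
Qed.

(** The inequality [|x| <= t + x^2 / t], averaged over the starting point.  With
    the free parameter [t] it plays the role of the Cauchy-Schwarz inequality and
    makes sense before [surp] is known to be finite almost everywhere. *)
Lemma mean_surp_dist n a : (mean_sqdev n a < +oo)%E ->
  mean_surp n a \is a fin_num /\ forall t, 0 < t ->
  `|fine (mean_surp n a) - n%:R * c| <= t + fine (mean_sqdev n a) / t.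
Proof.
move=> Dfin; set D := mean_sqdev n a in Dfin *; set m := n%:R * c.
have D0 : (0 <= D)%E by exact: mean_sqdev_ge0.
have m0 : 0 <= m by rewrite mulr_ge0// mulr_ge0// ln_ge0// ler1n.
have ms : measurable_fun setT (fun z => sqdev n a z).
  exact: (measurableT_comp (measurable_sqdev n) (measurable_pair1 a)).
have mk := @measurable_surp2 n a.
have s0 := surp_ge0 n a; have d0 := sqdev_ge0 n a.
have up t : 0 < t -> (mean_surp n a <= (m + t)%:E + t^-1%:E * D)%E.
  move=> t0; have ti : (0 <= t^-1%:E)%E by rewrite lee_fin invr_ge0 ltW.
  have mt : (0 <= (m + t)%:E)%E by rewrite lee_fin addr_ge0// ltW.
  rewrite /D /mean_sqdev -ge0_integralZl//.
  rewrite -(integral_prob_cstD U mt); last 2 first.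
  - exact: emeasurable_funM.
  - by move=> z; rewrite mule_ge0.
  apply: ge0_le_integral => //.
  - by apply: emeasurable_funD => //; exact: emeasurable_funM.
  - move=> z _; have := s0 z; rewrite /sqdev -/m; case: (surp n a z) => [k||]// _; last first.
      by rewrite (_ : +oo - m%:E = +oo)%E// mulyy gt0_muley ?lte_fin ?invr_gt0// addey.
    rewrite -EFinB -!EFinM -EFinD lee_fin.
    rewrite -subr_ge0 (_ : _ - _ = (t ^+ 2 - t * (k - m) + (k - m) ^+ 2) / t); last first.
      by field; rewrite gt_eqF.
    apply: divr_ge0; last exact: ltW.
    by have := sqr_ge0 (t - (k - m) / 2); have := sqr_ge0 (k - m); nra.
have lo t : 0 < t -> (m%:E <= mean_surp n a + (t%:E + t^-1%:E * D))%E.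
  move=> t0; have ti : (0 <= t^-1%:E)%E by rewrite lee_fin invr_ge0 ltW.
  have tt : (0 <= t%:E)%E by rewrite lee_fin ltW.
  rewrite /D /mean_sqdev -ge0_integralZl//.
  rewrite -(integral_prob_cstD U tt); last 2 first.
  - exact: emeasurable_funM.
  - by move=> z; rewrite mule_ge0.
  rewrite /mean_surp -ge0_integralD//; last 2 first.
  - by move=> z _; rewrite adde_ge0// mule_ge0.
  - by apply: emeasurable_funD => //; exact: emeasurable_funM.
  have -> : m%:E = (\int[U]_z (cst m%:E z))%E.
    by rewrite integral_cst//= probability_setT mule1.
  apply: ge0_le_integral => //.
  - apply: emeasurable_funD => //.
    by apply: emeasurable_funD => //; exact: emeasurable_funM.
  - move=> z _ /=; have := s0 z; rewrite /sqdev -/m; case: (surp n a z) => [k||]// k0.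
      rewrite -EFinB -!EFinM -!EFinD lee_fin.
      rewrite -subr_ge0 (_ : _ - _ = (t ^+ 2 + t * (k - m) + (k - m) ^+ 2) / t); last first.
        by field; rewrite gt_eqF.
      apply: divr_ge0; last exact: ltW.
      by have := sqr_ge0 (t + (k - m) / 2); have := sqr_ge0 (k - m); nra.
    rewrite addye ?leey// gt_eqF// (lt_le_trans (ltNyr 0))// adde_ge0// mule_ge0//.
have DE : D = (fine D)%:E by rewrite fineK// ge0_fin_numE.
have Kfin : mean_surp n a \is a fin_num.
  rewrite ge0_fin_numE ?mean_surp_ge0//; apply: (le_lt_trans (up 1 ltr01)).
  by rewrite DE -EFinM -EFinD ltry.
split => // t t0; have := up t t0; have := lo t t0.
rewrite -(fineK Kfin) DE -!EFinM -!EFinD !lee_fin /= ler_norml.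
rewrite (mulrC t^-1); set x := _ / t.
by move=> h1 h2; apply/andP; split; lra.
Qed.

(** The expectations of these nonnegative terms are a constant times [1 / (k+1)^2],
    so the series of the terms has finite expectation; it converges almost surely
    and its terms tend to zero. *)
Lemma ae_squares : {ae Q, forall a, (forall k, mean_sqdev (k.+1 ^ 2) a < +oo)%E /\
  fine (mean_sqdev (k.+1 ^ 2) a) / (k.+1 ^ 2)%:R ^+ 2 @[k --> \oo] --> (0 : R)}.
Proof.
pose N k : R := (k.+1 ^ 2)%:R.
have N0 k : 0 < N k by rewrite ltr0n expn_gt0.
pose g k (a : @phases R) : \bar R := ((N k ^+ 2)^-1%:E * mean_sqdev (k.+1 ^ 2) a)%E.
have Ni k : (0 <= (N k ^+ 2)^-1%:E)%E by rewrite lee_fin invr_ge0 sqr_ge0.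
have g0 k a : (0 <= g k a)%E by rewrite mule_ge0 ?mean_sqdev_ge0.
have mg k : measurable_fun setT (g k).
  by apply: emeasurable_funM => //; exact: measurable_mean_sqdev.
have mS : measurable_fun setT (fun a => \sum_(0 <= k <oo) g k a)%E.
  exact: ge0_emeasurable_sum.
have S0 a : (0 <= \sum_(0 <= k <oo) g k a)%E by exact: nneseries_ge0.
have iS : Q.-integrable setT (fun a => \sum_(0 <= k <oo) g k a)%E.
  apply/integrableP; split => //.
  under eq_integral do rewrite gee0_abs//.
  rewrite integral_nneseries//.
  rewrite (eq_eseriesr (g := fun k => ((psi_moment2 - c ^+ 2) / (k.+1 ^ 2)%:R)%:E)); last first.
    move=> k _; rewrite ge0_integralZl//; last 2 first.
    - exact: measurable_mean_sqdev.
    - by move=> a _; exact: mean_sqdev_ge0.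
    rewrite expect_mean_sqdev -EFinM; congr EFin; rewrite -/(N k).
    by field; rewrite gt_eqF.
  by apply: nneseries_inv_squares_fin; exact: variance_ge0.
have := integrable_ae measurableT iS.
apply: filterS => a /(_ I) Sfin.
have gfin k : (g k a < +oo)%E.
  apply: (@le_lt_trans _ _ (\sum_(0 <= k <oo) g k a)%E); last first.
    by move: Sfin; rewrite ge0_fin_numE.
  apply: (@le_trans _ _ (\sum_(0 <= i < k.+1) g i a)%E).
    by rewrite big_nat_recr//= leeDr// sume_ge0.
  by apply: nneseries_lim_ge => i _ _.
have Dfin k : (mean_sqdev (k.+1 ^ 2) a < +oo)%E.
  have := gfin k; rewrite /g; case: (mean_sqdev _ a) (mean_sqdev_ge0 (k.+1 ^ 2) a) => [r||]// _.
    by move=> _; exact: ltry.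
  by rewrite gt0_muley// lte_fin invr_gt0 exprn_gt0.
split => //.
have gE k : g k a = (fine (mean_sqdev (k.+1 ^ 2) a) / N k ^+ 2)%:E.
  rewrite /g mulrC EFinM fineK// ge0_fin_numE ?mean_sqdev_ge0//.
apply: cvg_series_cvg_0.
apply: nondecreasing_is_cvgn.
  apply/nondecreasing_seqP => n; rewrite /series/= big_nat_recr//= lerDl.
  by rewrite -lee_fin -gE.
exists (fine (\sum_(0 <= k <oo) g k a)%E) => _ [n _ <-].
rewrite -lee_fin fineK// /series/= -sumEFin.
rewrite (eq_bigr (fun k => g k a)); last by move=> k _; rewrite gE.
by apply: nneseries_lim_ge => i _ _.
Qed.

Lemma ae_mean_surp : {ae Q, forall a, (forall n, mean_surp n a \is a fin_num) /\
  fine (mean_surp n a) / n%:R @[n --> \oo] --> c}.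
Proof.
have := ae_squares; apply: filterS => a [Dfin Dcvg].
have sqfin k := (mean_surp_dist (Dfin k)).1.
have Kfin n : mean_surp n a \is a fin_num.
  rewrite ge0_fin_numE ?mean_surp_ge0//.
  apply: (@le_lt_trans _ _ (mean_surp (n.+1 ^ 2) a)).
    by apply: mean_surp_homo; rewrite (leq_trans (leqnSn n))// -[leqLHS]expn1 leq_pexp2l.
  by rewrite -ge0_fin_numE ?mean_surp_ge0.
split => //; apply: cvg_average_of_squares.
- by move=> m n mn; rewrite fine_le// mean_surp_homo.
- by move=> n; rewrite fine_ge0// mean_surp_ge0.
apply/cvgrPdist_le => e e0.
have e20 : 0 < e / 2 by rewrite divr_gt0.
have ee0 : 0 < (e / 2) ^+ 2 by rewrite exprn_gt0.
near=> k.
have N0 : 0 < (k.+1 ^ 2)%:R :> R by rewrite ltr0n expn_gt0.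
(* The parameter is chosen so that, after division by the square number [N], the
   first term of the bound is [e / 2]; eventually the second one is smaller. *)
have := (mean_surp_dist (Dfin k)).2 ((k.+1 ^ 2)%:R * (e / 2)).
have : fine (mean_sqdev (k.+1 ^ 2) a) / (k.+1 ^ 2)%:R ^+ 2 < (e / 2) ^+ 2.
  by near: k; exact: cvgr_lt Dcvg _ ee0.
move: N0; set N := (k.+1 ^ 2)%:R : R; set D := fine _; set K := fine _.
move=> N0 hD /(_ (mulr_gt0 N0 e20)) hK.
rewrite distrC (_ : K / N - c = (K - N * c) / N); last by field; rewrite gt_eqF.
rewrite normrM normfV (gtr0_norm N0) ler_pdivrMr//.
apply: (le_trans hK).
have : D / (N * (e / 2)) <= N * (e / 2).
  rewrite ler_pdivrMr ?mulr_gt0//.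
  move: hD; rewrite ltr_pdivrMr ?exprn_gt0// => /ltW hD; apply: (le_trans hD).
  by rewrite le_eqVlt; apply/orP; left; apply/eqP; ring.
by rewrite (_ : e * N = N * (e / 2) + N * (e / 2)) ?lerD2l//; field.
Unshelve. all: by end_near. Qed.

End strong_law.

(** * Relative entropies as averages over the unit interval *)

Section integral_of_difference.
Context d (T : measurableType d) (R : realType) (mu : {measure set T -> \bar R}).
Local Open Scope ereal_scope.

Lemma ge0_integrable (g : T -> \bar R) (r : R) : measurable_fun setT g ->
  (forall x, 0 <= g x) -> \int[mu]_x g x = r%:E -> mu.-integrable setT g.
Proof.
move=> mg g0 gr; apply/integrableP; split => //.
by under eq_integral do rewrite gee0_abs//; rewrite gr ltry.
Qed.

Variables (g : T -> \bar R) (h : T -> R) (r : R).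
Hypotheses (mg : measurable_fun setT g) (g0 : forall x, 0 <= g x).
Hypotheses (mh : measurable_fun setT h) (h0 : forall x, (0 <= h x)%R).
Hypothesis hr : \int[mu]_x (h x)%:E = r%:E.

Let k x := g x - (h x)%:E.

Let mk : measurable_fun setT k.
Proof. by apply: emeasurable_funB => //; exact/measurable_EFinP. Qed.

Let neg_fin : \int[mu]_x k^\- x < +oo.
Proof.
apply: (@le_lt_trans _ _ (\int[mu]_x (h x)%:E)); last by rewrite hr ltry.
apply: ge0_le_integral => //.
- exact: measurable_funeneg.
- exact/measurable_EFinP.
- move=> x _; rewrite funenegE /k ge_max lee_fin h0 andbT.
  by rewrite fin_num_oppeB// geeDr// oppe_le0.
Qed.

(** Only the negative part of the difference is known to be integrable, and the
    integral may be [+oo]; the identity [g + k^- = k^+ + h] for the difference [k] is between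
    nonnegative functions. *)
Lemma ge0_integralBl : \int[mu]_x (g x - (h x)%:E) = \int[mu]_x g x - r%:E.
Proof.
have kD x : g x + k^\- x = k^\+ x + (h x)%:E.
  rewrite funenegE funeposE /k; case: (g x) (g0 x) => [y||]// _.
    rewrite -EFinB -EFinN -!EFin_max -!EFinD; congr EFin.
    by have [h1|h1] := leP 0%R (y - h x)%R; rewrite /Num.max; do !case: ifPn; lra.
  have -> : +oo - (h x)%:E = +oo by rewrite addye.
  by rewrite maxNye maxye !addye.
have : \int[mu]_x g x + \int[mu]_x k^\- x = \int[mu]_x k^\+ x + \int[mu]_x (h x)%:E.
  rewrite -ge0_integralD//; last exact: measurable_funeneg.
  rewrite -ge0_integralD//; last 3 first.
  - exact: measurable_funepos.
  - by move=> x _; rewrite lee_fin.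
  - exact/measurable_EFinP.
  by apply: eq_integral.
rewrite hr (integralE mu setT k).
have n0 : 0 <= \int[mu]_x k^\- x by apply: integral_ge0.
have p0 : 0 <= \int[mu]_x k^\+ x by apply: integral_ge0.
have i0 : 0 <= \int[mu]_x g x by apply: integral_ge0.
move: n0 p0 i0 neg_fin.
case: (\int[mu]_x k^\- x) => [n||]//; case: (\int[mu]_x k^\+ x) => [p||]//;
  case: (\int[mu]_x g x) => [i||]// _ _ _ _.
by rewrite -!EFinD => -[e]; congr EFin; lra.
Qed.

Lemma ge0_integralBr : \int[mu]_x ((h x)%:E - g x) = r%:E - \int[mu]_x g x.
Proof.
transitivity (\int[mu]_x - k x).
  by apply: eq_integral => x _; rewrite /k fin_num_oppeB// addeC.
rewrite integralN; first by rewrite ge0_integralBl fin_num_oppeB// addeC.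
rewrite fin_num_adde_defl// fin_numN ge0_fin_numE//.
by apply: integral_ge0.
Qed.

End integral_of_difference.

Section relative_entropies.
Context {R : realType}.
Notation mu := (@lebesgue_measure R).
Notation U := (uniform_prob (@ltr01 R)).
Variables (f : R -> R) (n : nat) (a : nat -> R).
Hypothesis hf : Dplus f.
Local Notation F := (distr_fun f).

Let mF : measurable_fun setT F. Proof. exact: measurable_distr_fun. Qed.
Let mf : measurable_fun setT f. Proof. exact: measurable_density. Qed.

(** Where [f] is positive, so is [F], and [wcomp] is differentiable there; where
    [f] vanishes, both sides do. *)
Lemma iter_densityE x : iter_density f a n x = jac n a (F x) * f x.
Proof.
rewrite /iter_density; have [fx0|] := ltP 0 (f x); last first.
  move=> fx; have -> : f x = 0 by apply/eqP; rewrite eq_le fx density_ge0.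
  by rewrite !mulr0.
congr (_ * _); rewrite derive1E.
by have [_ ->] := is_derive_wcomp n a (distr_fun_gt0 hf fx0).
Qed.

Let nl2_ge0 : 0 <= n%:R * ln 2 :> R.
Proof. by rewrite mulr_ge0// ln_ge0// ler1n. Qed.

Let mjac : measurable_fun setT (jac n a : R -> R).
Proof. exact: (measurableT_comp (measurable_jac n) (measurable_pair1 (a : phases))). Qed.

Let msurp : measurable_fun setT (surp n a : R -> \bar R).
Proof. exact: (measurableT_comp (measurable_surp n) (measurable_pair1 (a : phases))). Qed.

Lemma rel_entropy_iter_density :
  rel_entropy f (iter_density f a n) = (mean_surp n a - (n%:R * ln 2)%:E)%E.
Proof.
have fx0 := density_ge0 hf.
transitivity (\int[mu]_x ((f x)%:E * surp n a (F x) - (f x * (n%:R * ln 2))%:E))%E.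
  apply: eq_integral => x _; rewrite iter_densityE /kl_integrand.
  case: eqVneq => [->|fx]; first by rewrite mul0e mul0r sube0.
  have fp : 0 < f x by rewrite lt_neqAle eq_sym fx fx0.
  rewrite (EFinM (f x) (n%:R * ln 2)) -muleBr//; last by rewrite fin_num_adde_defl.
  rewrite -nlog_jac mulf_eq0 (negbTE fx) orbF.
  have := jac_ge0 n a (F x); rewrite le_eqVlt => /predU1P[<-|j0].
    by rewrite eqxx nlog_le0// gt0_muley.
  rewrite gt_eqF// nlog_gt0// -EFinM; congr (_ * _)%:E.
  by rewrite invfM mulrCA mulfV// mulr1 lnV.
rewrite (@ge0_integralBl _ _ _ mu _ _ (n%:R * ln 2)).
- by rewrite (integral_distr_fun hf msurp)// => z; exact: surp_ge0.
- apply: emeasurable_funM; first exact/measurable_EFinP.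
  exact: (measurableT_comp msurp mF).
- by move=> x; rewrite mule_ge0 ?surp_ge0// lee_fin.
- exact: measurable_funM.
- by move=> x; rewrite mulr_ge0.
- rewrite (integral_distr_fun hf (measurable_cst (n%:R * ln 2)%:E))//.
  by rewrite integral_cst//= probability_setT mule1.
Qed.

Lemma rel_entropy_iter_density_rev :
  rel_entropy (iter_density f a n) f =
  ((n%:R * ln 2)%:E * \int[U]_z (jac n a z)%:E -
   \int[U]_z ((jac n a z)%:E * surp n a z))%E.
Proof.
have fx0 := density_ge0 hf.
have js0 z : (0 <= (jac n a z)%:E * surp n a z)%E.
  by rewrite mule_ge0 ?surp_ge0// lee_fin jac_ge0.
have mjs : measurable_fun setT (fun z : R => (jac n a z)%:E * surp n a z)%E.
  by apply: emeasurable_funM => //; exact/measurable_EFinP.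
have Efin : (\int[U]_z (jac n a z)%:E)%E \is a fin_num.
  rewrite ge0_fin_numE; last by apply: integral_ge0 => z _; rewrite lee_fin jac_ge0.
  apply: (@le_lt_trans _ _ (\int[U]_z (cst (2 ^+ n)%:E z))%E).
    apply: ge0_le_integral => //; try by move=> z _; rewrite lee_fin jac_ge0.
    - exact/measurable_EFinP.
    - by move=> z _; rewrite lee_fin jac_le.
  by rewrite integral_cst//= probability_setT mule1 ltry.
transitivity (\int[mu]_x ((f x * (n%:R * ln 2 * jac n a (F x)))%:E -
    (f x)%:E * ((jac n a (F x))%:E * surp n a (F x))))%E.
  apply: eq_integral => x _; rewrite iter_densityE /kl_integrand.
  have := jac_ge0 n a (F x); rewrite le_eqVlt => /predU1P[<-|j0].
    by rewrite mul0r eqxx mul0e mule0 !mulr0 sube0.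
  have [->|fx] := eqVneq (f x) 0; first by rewrite mulr0 eqxx mul0r mul0e sube0.
  rewrite mulf_eq0 (gt_eqF j0) (negbTE fx) /= mulfK//.
  have := nlog_jac n a (F x); rewrite nlog_gt0//.
  case: (surp n a (F x)) => [s||]//.
  rewrite -EFinB -!EFinM -EFinB => -[e]; congr EFin.
  have -> : ln (jac n a (F x)) = n%:R * ln 2 - s by rewrite -[LHS]opprK e opprB.
  by ring.
rewrite (@ge0_integralBr _ _ _ mu _ _
  (fine ((n%:R * ln 2)%:E * \int[U]_z (jac n a z)%:E)%E)).
- rewrite fineK ?fin_numM//.
  by rewrite (integral_distr_fun hf mjs).
- apply: emeasurable_funM; first exact/measurable_EFinP.
  exact: (measurableT_comp mjs mF).
- by move=> x; rewrite mule_ge0 ?lee_fin.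
- apply: measurable_funM => //; apply: measurable_funM => //.
  exact: (measurableT_comp mjac mF).
- by move=> x; rewrite !mulr_ge0// ?ln_ge0 ?ler1n ?jac_ge0.
- rewrite fineK ?fin_numM// -ge0_integralZl//; last 2 first.
  + exact/measurable_EFinP.
  + by move=> z _; rewrite lee_fin jac_ge0.
  rewrite -(integral_distr_fun hf)//.
  + by apply: emeasurable_funM => //; exact/measurable_EFinP.
  + by move=> z; rewrite mule_ge0// lee_fin jac_ge0.
Qed.

End relative_entropies.

(** * The law of the phases *)

Section law_of_phases.
Context d (T : measurableType d) (R : realType) (P : probability T R).
Variable alpha : nat -> {RV P >-> R}.

Definition phase_seq (w : T) : @phases R := fun j => alpha j w.

Lemma measurable_phase_seq : measurable_fun setT phase_seq.
Proof. by apply: measurable_to_phases => j; exact: measurable_funPT. Qed.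

HB.instance Definition _ := isMeasurableFun.Build _ _ _ _ phase_seq
  measurable_phase_seq.

Definition phase_law : probability (@phases R) R :=
  distribution P (phase_seq : {mfun T >-> @phases R}).

Lemma phase_law_box : (forall j, uniform01 (alpha j)) ->
  mutually_independent alpha ->
  forall n B, (forall j, measurable (B j)) ->
  phase_law (box n B) = (\prod_(j < n) uniform_prob (@ltr01 R) (B j))%E.
Proof.
move=> unif indep n B mB.
rewrite -(big_mkord xpredT (fun j => uniform_prob (@ltr01 R) (B j))).
rewrite (eq_bigr (fun j => P (alpha j @^-1` B j))); last first.
  by move=> j _; rewrite -(unif j (B j) (mB j)).
rewrite /index_iota subn0 -indep//; last exact: iota_uniq.
rewrite /phase_law /= /distribution /pushforward; congr (P _).
apply/seteqP; split => w /= H j.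
  by rewrite /= mem_iota add0n => /andP[_ jn]; exact: H.
by move=> jn; apply: H; rewrite /= mem_iota add0n.
Qed.

Lemma ae_phase_law (X : set (@phases R)) :
  {ae phase_law, forall a, X a} -> {ae P, forall w, X (phase_seq w)}.
Proof.
move=> [N [mN N0 XN]]; exists (phase_seq @^-1` N); split.
- by rewrite -[X in measurable X]setTI; exact: measurable_phase_seq.
- exact: N0.
- by move=> w /= Xw; exact: XN.
Qed.

End law_of_phases.

Theorem theorem38 (R : realType) (d : measure_display) (T : measurableType d)
    (P : probability T R) (alpha : nat -> {RV P >-> R})
    (alpha_unif : forall j, uniform01 (alpha j))
    (alpha_indep : mutually_independent alpha)
    (f : R -> R) (hf : Dplus f) :
  let f_ (n : nat) (w : T) := iter_density f (fun j => alpha j w) n in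
  [/\ forall n : nat,
        has_expectation P (fun w => rel_entropy f (f_ n w)) (n%:R * ln 2),
      forall n : nat,
        has_expectation P (fun w => rel_entropy (f_ n w) f)
          (n%:R * (1 - ln 2)) &
      {ae P, forall w,
        ((n%:R^-1)%:E * rel_entropy f (f_ n w))%E @[n --> \oo]
          --> (ln 2)%:E}].
Proof.
have QE := phase_law_box alpha_unif alpha_indep.
pose U := uniform_prob (@ltr01 R).
move=> f_.
(* Nonnegative functions of the phases may be integrated against the law of the
   sequence of phases. *)
have transfer (g : @phases R -> \bar R) (r : R) : measurable_fun setT g ->
    (forall a, (0 <= g a)%E) -> (\int[phase_law alpha]_a g a = r%:E)%E ->
    (\int[P]_w g (phase_seq alpha w) = r%:E)%E /\
    P.-integrable setT (g \o phase_seq alpha).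
  move=> mg g0 gr.
  have e : (\int[P]_w g (phase_seq alpha w) = r%:E)%E.
    by rewrite -gr /phase_law ge0_integral_distribution.
  split => //; apply: (@ge0_integrable _ _ _ P _ r) => //.
    exact: (measurableT_comp mg (measurable_phase_seq alpha)).
  by move=> w; exact: g0.
split.
- move=> n.
  have [e i] := transfer _ _ (measurable_mean_surp n) (mean_surp_ge0 n)
    (expect_mean_surp QE n).
  rewrite /has_expectation (_ : (fun w => _) = fun w =>
      (mean_surp n (phase_seq alpha w) - (cst (n%:R * ln 2)%:E w))%E); last first.
    by apply/funext => w; rewrite rel_entropy_iter_density.
  have ic : P.-integrable setT (cst (n%:R * ln 2)%:E : T -> \bar R).
    exact: finite_measure_integrable_cst.
  split; first exact: integrableB.
  rewrite integralB// e integral_cst//= probability_setT mule1 -EFinB.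
  by congr EFin; ring.
- move=> n.
  have mj : measurable_fun setT (fun p : @phases R * R => (jac n p.1 p.2)%:E).
    by apply/measurable_EFinP; exact: measurable_jac.
  have j0 a z : (0 <= (jac n a z)%:E :> \bar R)%E by rewrite lee_fin jac_ge0.
  have mjs : measurable_fun setT
      (fun p : @phases R * R => (jac n p.1 p.2)%:E * surp n p.1 p.2)%E.
    by apply: emeasurable_funM => //; exact: measurable_surp.
  have js0 a z : (0 <= (jac n a z)%:E * surp n a z :> \bar R)%E.
    by rewrite mule_ge0 ?surp_ge0.
  have [e1 i1] : (\int[P]_w \int[U]_z (jac n (phase_seq alpha w) z)%:E = 1%:E)%E /\
      P.-integrable setT (fun w => \int[U]_z (jac n (phase_seq alpha w) z)%:E)%E.
    apply: (transfer (fun a => \int[U]_z (jac n a z)%:E)%E).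
    - apply: (@measurable_fun_fubini_tonelli_F _ _ _ _ _ U _ mj).
      by move=> p; exact: j0.
    - by move=> a; apply: integral_ge0 => z _; exact: j0.
    - apply: (@expect_average _ (phase_law alpha)
        (fun a z => (jac n a z)%:E) 1%:E) => //.
      by move=> z z0; exact: expect_jac.
  have [e2 i2] : (\int[P]_w \int[U]_z ((jac n (phase_seq alpha w) z)%:E *
        surp n (phase_seq alpha w) z) = (n%:R * (2 * ln 2 - 1))%:E)%E /\
      P.-integrable setT (fun w => \int[U]_z ((jac n (phase_seq alpha w) z)%:E *
        surp n (phase_seq alpha w) z))%E.
    apply: (transfer (fun a => \int[U]_z ((jac n a z)%:E * surp n a z))%E).
    - apply: (@measurable_fun_fubini_tonelli_F _ _ _ _ _ U _ mjs).
      by move=> p; exact: js0.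
    - by move=> a; apply: integral_ge0 => z _; exact: js0.
    - apply: (@expect_average _ (phase_law alpha)
        (fun a z => (jac n a z)%:E * surp n a z)%E) => //.
      by move=> z z0; exact: expect_jac_surp.
  rewrite /has_expectation (_ : (fun w => _) = fun w =>
      ((n%:R * ln 2)%:E * \int[U]_z (jac n (phase_seq alpha w) z)%:E -
       \int[U]_z ((jac n (phase_seq alpha w) z)%:E *
        surp n (phase_seq alpha w) z))%E); last first.
    by apply/funext => w; rewrite rel_entropy_iter_density_rev.
  have i1' := integrableZl measurableT (n%:R * ln 2) i1.
  split; first exact: integrableB.
  rewrite integralB// integralZl// e1 e2 mule1 -EFinB.
  by congr EFin; ring.
- have := ae_phase_law (ae_mean_surp QE).
  apply: filterS => w [Kfin Kcvg].
  rewrite (_ : (fun n => _) = EFin \o (fun n =>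
      fine (mean_surp n (phase_seq alpha w)) / n%:R - n%:R^-1 * (n%:R * ln 2))).
    apply: cvg_EFin; first exact: nearW.
    have e : 2 * ln 2 - ln 2 = ln 2 :> R by ring.
    rewrite -[X in _ --> X]e.
    apply: cvgB => //.
    apply: cvg_near_cst; near=> n.
    by rewrite mulKf// pnatr_eq0 -lt0n; near: n; exact: nbhs_infty_gt.
  apply/funext => n; rewrite rel_entropy_iter_density//.
  rewrite -[X in (X - _)%E](fineK (Kfin n)) -EFinB -EFinM mulrBr /=.
  by rewrite (mulrC _ (fine _)).
Unshelve. all: by end_near. Qed.
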